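(* Let $k\ge1$ and let $G,H$ be simple graphs with $|V(G)|=|V(H)|$. Then $G$ and $H$ are homomorphism indistinguishable over $\mathcal P_k$ (i.e. $\hom(F,G)=\hom(F,H)$ for every underlying graph $F$ of a member of $\mathcal P_k$) if and only if they are algebraically $k$-equivalent.
   Context: Bilabelled graphs: $(k,k)$-bilabelled $\boldsymbol F=(F,\boldsymbol u,\boldsymbol v)$, $\boldsymbol u,\boldsymbol v\in V(F)^k$; $\boldsymbol F_G\in\mathbb C^{V(G)^k\times V(G)^k}$ has $(\boldsymbol x,\boldsymbol y)$-entry the number of homomorphisms $h:F\to G$ with $h(u_i)=x_i,h(v_i)=y_i$. Series composition $\boldsymbol F\cdot\boldsymbol F'$ glues $v_i$ to $u'_i$ (labels $\boldsymbol u,\boldsymbol v'$); parallel composition $\boldsymbol F\odot\boldsymbol F'$ identifies $u_i$ with $u'_i$, $v_i$ with $v'_i$; multiple edges removed. For $\sigma\in\mathfrak S_{2k}$, $\boldsymbol F^\sigma$ has in-labels $(w_{\sigma(1)},\dots,w_{\sigma(k)})$, out-labels $(w_{\sigma(k+1)},\dots,w_{\sigma(2k)})$ with $\boldsymbol w=\boldsymbol u\boldsymbol v$; for matrices, $(X^\sigma)_{\boldsymbol z}=X_{\boldsymbol w}$ with $w_{\sigma(i)}=z_i$. $\mathscr C_k$ = cyclic group of rotations of $(1,\dots,k,2k,\dots,k+1)$. Bilabelled minors: via edge contraction, edge deletion, deletion of unlabelled vertices. $\boldsymbol C_k$: vertices $[2k]$, in-labels $(1,\dots,k)$, out-labels $(k+1,\dots,2k)$,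 edges $\{i,i+1\}$ ($i\in[2k]\setminus\{k,2k\}$), $\{1,k+1\},\{k,2k\}$; $\boldsymbol M_k$: same vertices/labels, edges $\{i,i+k\}$. $\mathcal Q_k^P,\mathcal Q_k^S$ = bilabelled minors of $\boldsymbol C_k,\boldsymbol M_k$; $\mathcal Q_k$ their union. $\mathcal P_k$ = smallest class containing $\mathcal Q_k$ closed under series composition, $\boldsymbol F\mapsto\boldsymbol F\odot\boldsymbol Q$ ($\boldsymbol Q\in\mathcal Q_k^P$), $\boldsymbol F\mapsto\boldsymbol F^\sigma$ ($\sigma\in\mathscr C_k$). Algebraic $k$-equivalence: $\widehat{\mathcal Q}^k_G$ is the smallest subalgebra of $\mathbb C^{V(G)^k\times V(G)^k}$ containing $I$ and the all-ones $J$, closed under conjugate transpose, under $X\mapsto\boldsymbol F_G\odot X$ ($\boldsymbol F\in\mathcal Q_k^P$, $\odot$ entrywise), under $X\mapsto X^\sigma$ ($\sigma\in\mathscr C_k$), and containing all $\boldsymbol F_G$, $\boldsymbol F\in\mathcal Q_k$. $G,H$ are algebraically $k$-equivalent if there is a vector space isomorphism $\varphi:\widehat{\mathcal Q}^k_G\to\widehat{\mathcal Q}^k_H$ with $\varphi(M^* )=\varphi(M)^*$, $\varphi(MN)=\varphi(M)\varphi(N)$, $\varphi(\boldsymbol F_G\odot M)=\boldsymbol F_H\odot\varphi(M)$ ($\boldsymbol F\in\mathcal Q_k^P$), $\varphi(I)=I$, $\varphi(J)=J$, $\varphi(\boldsymbol F_G)=\boldsymbol F_H$ ($\boldsymbol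 F\in\mathcal Q_k$), $\varphi(M^\sigma)=\varphi(M)^\sigma$ ($\sigma\in\mathscr C_k$), $\mathrm{tr}\,\varphi(M)=\mathrm{tr}\,M$, for all $M,N$. *)

(* Defs.v *)
From HB Require Import structures.
From mathcomp Require Import all_boot all_algebra.
From mathcomp Require Import complex Rstruct.
Unset Printing Implicit Defensive.
Import GRing.Theory.
Local Open Scope ring_scope.

Definition CC : Type := (Rdefinitions.R)[i].

Definition simple_graph (V : finType) (e : rel V) : Prop :=
  symmetric e /\ irreflexive e.

Section Bilabelled.
Variable k : nat.

Record bgraph := BGraph {
  bV : finType;
  bE : rel bV;
  bin : k.-tuple bV;
  bout : k.-tuple bV }.

Definition img_type (T T' : finType) (f : T -> T') : finType :=
  {y : T' | y \in f @: [set: T]}.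
Arguments img_type {T T'} f.

Definition img_elt (T T' : finType) (f : T -> T') (x : T) : img_type f :=
  exist (fun y => y \in f @: [set: T]) (f x) (imset_f f (in_setT x)).

Arguments img_elt {T T'} f x.

Definition map_bg (F : bgraph) (T' : finType) (f : bV F -> T') : bgraph :=
  @BGraph (img_type f)
    (fun a b => [exists x, exists y,
                  [&& bE F x y, f x == val a & f y == val b]])
    (map_tuple (img_elt f) (bin F)) (map_tuple (img_elt f) (bout F)).

Arguments map_bg F {T'} f.

(* quotient by the equivalence relation generated by R
   (each vertex is sent to a canonical representative of its class) *)
Definition quot_bg (F : bgraph) (R : rel (bV F)) : bgraph :=
  @map_bg F (bV F) (fingraph.root (fun x y => R x y || R y x)).

Definition sum_rel (T T' : finType) (e : rel T) (e' : rel T') : rel (T + T') :=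
  fun a b => match a, b with
             | inl x, inl y => e x y
             | inr x, inr y => e' x y
             | _, _ => false end.

Arguments sum_rel {T T'} e e' a b.

Definition series (F F' : bgraph) : bgraph :=
  quot_bg
    (@BGraph (bV F + bV F')%type (sum_rel (bE F) (bE F'))
       (map_tuple (@inl (bV F) (bV F')) (bin F))
       (map_tuple (@inr (bV F) (bV F')) (bout F')))
    (fun a b => [exists i : 'I_k,
        (a == inl (tnth (bout F) i)) && (b == inr (tnth (bin F') i))]).

Definition parallel (F F' : bgraph) : bgraph :=
  quot_bg
    (@BGraph (bV F + bV F')%type (sum_rel (bE F) (bE F'))
       (map_tuple (@inl (bV F) (bV F')) (bin F))
       (map_tuple (@inl (bV F) (bV F')) (bout F)))
    (fun a b => [exists i : 'I_k,
        ((a == inl (tnth (bin F) i)) && (b == inr (tnth (bin F') i)))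
     || ((a == inl (tnth (bout F) i)) && (b == inr (tnth (bout F') i)))]).

(* ---- the cyclic group C_k of rotations of (1,...,k,2k,...,k+1) ----
   0-indexed, the cyclic sequence is (0,...,k-1,2k-1,...,k); cyc_swap maps an
   element to its position in that sequence and back (it is an involution). *)
Definition cyc_swap (p : nat) : nat := if (p < k)%N then p else (3 * k - 1 - p)%N.

Definition sigma (j : nat) (x : 'I_(k + k)) : 'I_(k + k) :=
  insubd x (cyc_swap ((cyc_swap x + j) %% (k + k))).

Definition rot_bg (j : nat) (F : bgraph) : bgraph :=
  @BGraph (bV F) (bE F)
    [tuple tnth (cat_tuple (bin F) (bout F)) (sigma j (lshift k i)) | i < k]
    [tuple tnth (cat_tuple (bin F) (bout F)) (sigma j (rshift k i)) | i < k].

Definition del_edge (F : bgraph) (a b : bV F) : bgraph :=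
  @BGraph (bV F)
    (fun x y => bE F x y && ~~ (((x == a) && (y == b)) || ((x == b) && (y == a))))
    (bin F) (bout F).

Definition contract (F : bgraph) (a b : bV F) : bgraph :=
  quot_bg (del_edge F a b) (fun x y => (x == a) && (y == b)).

Definition labels (F : bgraph) : seq (bV F) := val (bin F) ++ val (bout F).

Lemma del_in_ok (F : bgraph) (a : bV F) (H : a \notin labels F) (i : 'I_k) :
  tnth (bin F) i != a.
Proof. by apply/eqP => e; move: H; rewrite /labels mem_cat -e mem_tnth. Qed.
Arguments del_in_ok {F a} H i.

Lemma del_out_ok (F : bgraph) (a : bV F) (H : a \notin labels F) (i : 'I_k) :
  tnth (bout F) i != a.
Proof. by apply/eqP => e; move: H; rewrite /labels mem_cat -e mem_tnth orbT. Qed.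
Arguments del_out_ok {F a} H i.

Definition del_vertex (F : bgraph) (a : bV F) (H : a \notin labels F) : bgraph :=
  @BGraph {x : bV F | x != a}
    (fun x y => bE F (val x) (val y))
    [tuple exist (fun x => x != a) (tnth (bin F) i) (del_in_ok H i) | i < k]
    [tuple exist (fun x => x != a) (tnth (bout F) i) (del_out_ok H i) | i < k].

Arguments del_vertex {F a} H.

(* minor_of F0 F : F is a bilabelled minor of F0 *)
Inductive minor_of (F0 : bgraph) : bgraph -> Prop :=
| mo_refl : minor_of F0 F0
| mo_del_edge (F : bgraph) (a b : bV F) :
    minor_of F0 F -> bE F a b -> minor_of F0 (del_edge F a b)
| mo_contract (F : bgraph) (a b : bV F) :
    minor_of F0 F -> bE F a b -> a != b -> minor_of F0 (contract F a b)
| mo_del_vertex (F : bgraph) (a : bV F) (H : a \notin labels F) :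
    minor_of F0 F -> minor_of F0 (del_vertex H).

Definition in_lab : k.-tuple 'I_(k + k) := [tuple lshift k i | i < k].
Definition out_lab : k.-tuple 'I_(k + k) := [tuple rshift k i | i < k].

Definition Cedge (x y : 'I_(k + k)) : bool :=
  let a := nat_of_ord x in let b := nat_of_ord y in
  [|| [&& b == a.+1, a != k.-1 & a != (k + k).-1],
      (a == 0%N) && (b == k)
    | (a == k.-1) && (b == (k + k).-1)].

Definition Ck : bgraph :=
  @BGraph 'I_(k + k) (fun x y => Cedge x y || Cedge y x) in_lab out_lab.

Definition Medge (x y : 'I_(k + k)) : bool :=
  (nat_of_ord x < k)%N && (nat_of_ord y == nat_of_ord x + k)%N.

Definition Mk : bgraph :=
  @BGraph 'I_(k + k) (fun x y => Medge x y || Medge y x) in_lab out_lab.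

Definition inQP (F : bgraph) : Prop := minor_of Ck F.
Definition inQS (F : bgraph) : Prop := minor_of Mk F.
Definition inQ (F : bgraph) : Prop := inQP F \/ inQS F.

Inductive inP : bgraph -> Prop :=
| P_Q (F : bgraph) : inQ F -> inP F
| P_series (F F' : bgraph) : inP F -> inP F' -> inP (series F F')
| P_par (F Q : bgraph) : inP F -> inQP Q -> inP (parallel F Q)
| P_rot (j : nat) (F : bgraph) : inP F -> inP (rot_bg j F).

Definition is_hom (F : bgraph) (V : finType) (e : rel V) (h : {ffun bV F -> V}) : bool :=
  [forall x, forall y, bE F x y ==> e (h x) (h y)].
Arguments is_hom F {V} e h.

Definition hom (F : bgraph) (V : finType) (e : rel V) : nat :=
  #|[set h : {ffun bV F -> V} | is_hom F e h]|.
Arguments hom F {V} e.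

Definition hom_indist_P (V V' : finType) (e : rel V) (e' : rel V') : Prop :=
  forall F : bgraph, inP F -> hom F e = hom F e'.

Definition mx (V : finType) : Type := k.-tuple V -> k.-tuple V -> CC.

Definition homMx (F : bgraph) (V : finType) (e : rel V) : mx V :=
  fun x y => (#|[set h : {ffun bV F -> V} | is_hom F e h &&
     [forall i, (h (tnth (bin F) i) == tnth x i) && (h (tnth (bout F) i) == tnth y i)]]|)%:R.

Arguments homMx F {V} e.

Section Mx.
Variable V : finType.
Definition mxI : mx V := fun x y => (x == y)%:R.
Definition mxJ : mx V := fun _ _ => 1.
Definition mxadd (X Y : mx V) : mx V := fun x y => X x y + Y x y.
Definition mxscale (c : CC) (X : mx V) : mx V := fun x y => c * X x y.
Definition mxmul (X Y : mx V) : mx V := fun x z => \sum_(y : k.-tuple V) X x y * Y y z.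
Definition mxadj (X : mx V) : mx V := fun x y => conjc (X y x).
Definition mxhad (X Y : mx V) : mx V := fun x y => X x y * Y x y.
Definition mxtr (X : mx V) : CC := \sum_(x : k.-tuple V) X x x.
(* (X^sigma)_z = X_w where w_{sigma(i)} = z_i, z = x y *)
Definition mxrot (j : nat) (X : mx V) : mx V := fun x y =>
  let z := cat_tuple x y in
  let w := fun m : 'I_(k + k) => tnth z (odflt m [pick i | sigma j i == m]) in
  X [tuple w (lshift k i) | i < k] [tuple w (rshift k i) | i < k].
End Mx.
Arguments mxadd {V} X Y.
Arguments mxscale {V} c X.
Arguments mxmul {V} X Y.
Arguments mxadj {V} X.
Arguments mxhad {V} X Y.
Arguments mxtr {V} X.
Arguments mxrot {V} j X.

Inductive inQhat (V : finType) (e : rel V) : mx V -> Prop :=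
| Qh_I : inQhat V e (mxI V)
| Qh_J : inQhat V e (mxJ V)
| Qh_F (F : bgraph) : inQ F -> inQhat V e (homMx F e)
| Qh_add (X Y : mx V) : inQhat V e X -> inQhat V e Y -> inQhat V e (mxadd X Y)
| Qh_scale (c : CC) (X : mx V) : inQhat V e X -> inQhat V e (mxscale c X)
| Qh_mul (X Y : mx V) : inQhat V e X -> inQhat V e Y -> inQhat V e (mxmul X Y)
| Qh_adj (X : mx V) : inQhat V e X -> inQhat V e (mxadj X)
| Qh_had (F : bgraph) (X : mx V) : inQP F -> inQhat V e X -> inQhat V e (mxhad (homMx F e) X)
| Qh_rot (j : nat) (X : mx V) : inQhat V e X -> inQhat V e (mxrot j X).

Definition alg_equiv (V V' : finType) (e : rel V) (e' : rel V') : Prop :=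
  exists phi : mx V -> mx V',
    (forall X, inQhat V e X -> inQhat V' e' (phi X)) /\
    (forall Y, inQhat V' e' Y -> exists2 X, inQhat V e X & phi X = Y) /\
    (forall X Y, inQhat V e X -> inQhat V e Y -> phi X = phi Y -> X = Y) /\
    (forall (a b : CC) X Y, inQhat V e X -> inQhat V e Y ->
       phi (mxadd (mxscale a X) (mxscale b Y))
       = mxadd (mxscale a (phi X)) (mxscale b (phi Y))) /\
    (forall X, inQhat V e X -> phi (mxadj X) = mxadj (phi X)) /\
    (forall X Y, inQhat V e X -> inQhat V e Y -> phi (mxmul X Y) = mxmul (phi X) (phi Y)) /\
    (forall F X, inQP F -> inQhat V e X ->
       phi (mxhad (homMx F e) X) = mxhad (homMx F e') (phi X)) /\
    phi (mxI V) = mxI V' /\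
    phi (mxJ V) = mxJ V' /\
    (forall F, inQ F -> phi (homMx F e) = homMx F e') /\
    (forall j X, inQhat V e X -> phi (mxrot j X) = mxrot j (phi X)) /\
    (forall X, inQhat V e X -> mxtr (phi X) = mxtr X).

End Bilabelled.

(* Main.v *)
Require Import Defs.
From mathcomp Require Import all_boot all_algebra.
From mathcomp Require Import complex Rstruct zify perm.
From Stdlib Require Import FunctionalExtensionality ClassicalEpsilon.

(** Series composition, parallel composition and rotation of bilabelled graphs
    become matrix product, entrywise product and rotation of homomorphism
    matrices, and [hom F G] is the sum of the entries of [F_G].

    An algebraic equivalence fixes [J], maps [F_G] to [F_H] for every [F] in
    [P_k], and [J X J] is the sum of the entries of [X] times [J]; hence it
    preserves homomorphism counts.

    Conversely, the algebra of [G] is spanned by the matrices [F_G], [F] in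
    [P_k]: for the adjoint one uses that swapping in- and out-labels reflects
    the cyclic order, maps [C_k] and [M_k] to themselves and inverts rotations.
    The linear map sending [F_G] to [F_H] is well defined and injective as soon
    as it preserves traces, because [tr (Z^* Z) = 0] forces [Z = 0].  To read a
    trace off sums of entries, rotate by a quarter turn: the identity, which
    joins leg [i] of the in-labels to leg [i] of the out-labels, becomes nested
    caps inside the in-labels and inside the out-labels, plus one crossing wire
    when [k] is odd.  The crossing wire is closed up by identifying the last in-
    and out-labels, which a minor of [C_k] does. *)

Set Implicit Arguments.
Unset Strict Implicit.
Unset Printing Implicit Defensive.
Import GRing.Theory Num.Theory.
Local Open Scope ring_scope.

Arguments quot_bg {k} F R.
Arguments img_elt {T T'} f x.
Arguments img_type {T T'} f.
Arguments sum_rel {T T'} e e' a b.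
Arguments is_hom {k} F {V} e h.
Arguments Defs.hom {k} F {V} e.
Arguments homMx {k} F {V} e.
Arguments mxI {k} V.
Arguments mxJ {k} V.
Arguments mxadd {k V} X Y.
Arguments mxscale {k V} c X.
Arguments mxmul {k V} X Y.
Arguments mxadj {k V} X.
Arguments mxhad {k V} X Y.
Arguments mxtr {k V} X.
Arguments mxrot {k V} j X.
Arguments inQhat {k V} e X.
Arguments series {k} F F'.
Arguments parallel {k} F F'.
Arguments rot_bg {k} j F.
Arguments sigma {k} j x.
Arguments del_edge {k} F a b.
Arguments contract {k} F a b.
Arguments labels {k} F.
Arguments del_vertex {k F a} H.
Arguments minor_of {k} F0 F.
Arguments inQP {k} F.
Arguments inQS {k} F.
Arguments inP {k} F.
Arguments bV {k} b.
Arguments bE {k} b _ _.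
Arguments bin {k} b.
Arguments bout {k} b.
Arguments BGraph {k} bV bE bin bout.

Lemma mx_ext k (V : finType) (X Y : mx k V) : (forall x y, X x y = Y x y) -> X = Y.
Proof.
by move=> XY; apply: functional_extensionality => x; apply: functional_extensionality => y.
Qed.

(** * Homomorphism counts under quotients and gluings *)

Section HomCount.
Variable k : nat.
Implicit Type F : bgraph k.

Definition hcond F (V : finType) (e : rel V) (x y : k.-tuple V) (h : {ffun bV F -> V}) : bool :=
  [&& is_hom F e h, map_tuple h (bin F) == x & map_tuple h (bout F) == y].

Arguments hcond F {V} e x y h.

(** Natural-number form of the entries of [homMx]: a sum of truth values over all maps lets sums be
    exchanged and conditions be multiplied before any cast to [CC]. *)
Definition hcount F (V : finType) (e : rel V) (x y : k.-tuple V) : nat :=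
  (\sum_h hcond F e x y h)%N.

Lemma map_tuple_eqP (T V : finType) (f : T -> V) (t : k.-tuple T) (x : k.-tuple V) :
  reflect (forall i, f (tnth t i) = tnth x i) (map_tuple f t == x).
Proof.
apply: (iffP eqP) => [<- i|H]; first by rewrite tnth_map.
by apply: eq_from_tnth => i; rewrite tnth_map H.
Qed.

Lemma homMxE F (V : finType) (e : rel V) x y : homMx F e x y = (hcount F e x y)%:R.
Proof.
rewrite /homMx /hcount -sum1dep_card big_mkcond /=; congr (_%:R).
apply: eq_bigr => h _; rewrite /hcond; case: is_hom => //=.
have -> : [forall i, (h (tnth (bin F) i) == tnth x i) && (h (tnth (bout F) i) == tnth y i)]
   = (map_tuple h (bin F) == x) && (map_tuple h (bout F) == y).
  apply/forallP/andP => [H|[/map_tuple_eqP H1 /map_tuple_eqP H2] i]; last by rewrite H1 H2 !eqxx.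
  by split; apply/map_tuple_eqP => i; have /andP [/eqP ? /eqP ?] := H i.
by case: (_ && _).
Qed.

Lemma homE F (V : finType) (e : rel V) : Defs.hom F e = (\sum_x \sum_y hcount F e x y)%N.
Proof.
rewrite /Defs.hom -sum1dep_card big_mkcond /= (eq_bigr (fun h => \sum_x \sum_y hcond F e x y h)%N).
  by rewrite exchange_big; apply: eq_bigr => x _; rewrite /hcount exchange_big.
(* Each map [h] can contribute to one pair [(x, y)] only: the images of its label tuples. *)
move=> h _; rewrite (bigD1 (map_tuple h (bin F))) //= [X in (_ + X)%N]big1 ?addn0.
  rewrite (bigD1 (map_tuple h (bout F))) //= big1 ?addn0.
    by rewrite /hcond !eqxx !andbT; case: is_hom.
  by move=> y ny; rewrite /hcond eqxx eq_sym (negbTE ny) !andbF.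
by move=> x nx; rewrite big1 // => y _; rewrite /hcond [_ == x]eq_sym (negbTE nx) !andbF.
Qed.

Lemma is_homP F (V : finType) (e : rel V) (h : {ffun bV F -> V}) :
  reflect (forall a b, bE F a b -> e (h a) (h b)) (is_hom F e h).
Proof.
apply: (iffP forallP) => [H a b|H a]; first by move/forallP: (H a) => /(_ b) /implyP.
by apply/forallP => b; apply/implyP; apply: H.
Qed.

Definition constant_along (T V : finType) (R : rel T) (h : T -> V) : bool :=
  [forall a, forall b, R a b ==> (h a == h b)].

Lemma constant_alongP (T V : finType) (R : rel T) (h : T -> V) :
  reflect (forall a b, R a b -> h a = h b) (constant_along R h).
Proof.
apply: (iffP forallP) => [H a b|H a]; first by move/forallP: (H a) => /(_ b) /implyP Hab /Hab /eqP.
by apply/forallP => b; apply/implyP => /H ->.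
Qed.

Definition gen_root (T : finType) (R : rel T) : T -> T :=
  fingraph.root (fun x y => R x y || R y x).

Lemma gen_sym (T : finType) (R : rel T) : connect_sym (fun x y => R x y || R y x).
Proof. by apply: sym_connect_sym => x y; rewrite orbC. Qed.

Lemma gen_root_rel (T : finType) (R : rel T) a b : R a b -> gen_root R a = gen_root R b.
Proof.
by move=> Rab; rewrite /gen_root; apply/(fingraph.rootP (gen_sym R)); apply: connect1; rewrite Rab.
Qed.

(** Universal property of the quotient: equal roots are joined by a chain of [R]-steps in either
    direction, and [h] does not change along a step. *)
Lemma gen_rootE (T V : finType) (R : rel T) (h : T -> V) a b :
  (forall a b, R a b -> h a = h b) -> gen_root R a = gen_root R b -> h a = h b.
Proof.
rewrite /gen_root => hR /(fingraph.rootP (gen_sym R)) /connectP [p + ->].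
elim: p a => //= c p IH a /andP [/orP Rac /IH <-].
by case: Rac => /hR.
Qed.

Lemma gen_root_idem (T : finType) (R : rel T) a : gen_root R (gen_root R a) = gen_root R a.
Proof. by rewrite /gen_root root_root //; apply: gen_sym. Qed.

Lemma img_eltP (T T' : finType) (f : T -> T') (a : img_type f) : exists x, a = img_elt f x.
Proof.
case: a => a /[dup] /imsetP [x _ ->] H; exists x; exact: val_inj.
Qed.

(** Composition with the projection ([up]) identifies maps on the quotient with maps constant along
    [R]; [down] restricts to representatives. Edges of the quotient are the images of edges of [F],
    so homomorphisms correspond. *)
Lemma hcount_quot F R (V : finType) (e : rel V) x y :
  hcount (quot_bg F R) e x y =
  (\sum_(h : {ffun bV F -> V} | constant_along R h) hcond F e x y h)%N.
Proof.
set p := img_elt (gen_root R).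
pose up (g : {ffun bV (quot_bg F R) -> V}) : {ffun bV F -> V} := [ffun a => g (p a)].
pose down (h : {ffun bV F -> V}) : {ffun bV (quot_bg F R) -> V} :=
  [ffun a : bV (quot_bg F R) => h (val a)].
have upE g a : up g a = g (p a) by rewrite ffunE.
have updown (h : {ffun bV F -> V}) : constant_along R h -> up (down h) = h.
  move=> /constant_alongP hc; apply/ffunP => a.
  by rewrite upE ffunE /=; apply: (gen_rootE hc); apply: gen_root_idem.
rewrite (reindex_onto up down updown); apply: eq_big => [g|g _].
  apply/esym/andP; split.
    by apply/constant_alongP => a b Rab; rewrite !upE; congr (g _); apply: val_inj; apply: gen_root_rel.
  apply/eqP/ffunP => a; rewrite ffunE upE; have [b ->] := img_eltP a; congr (g _).
  by apply: val_inj; apply: gen_root_idem.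
congr (nat_of_bool _); rewrite /hcond; congr andb.
  apply/is_homP/is_homP => H a b.
    move=> Eab; rewrite !upE; apply: H => /=.
    by apply/existsP; exists a; apply/existsP; exists b; rewrite Eab !eqxx.
  move=> /= /existsP [a' /existsP [b' /and3P [Eab /eqP Ea /eqP Eb]]].
  have -> : a = p a' by apply: val_inj.
  have -> : b = p b' by apply: val_inj.
  by rewrite -!upE; apply: H.
have E (t : k.-tuple (bV F)) : map_tuple g (map_tuple p t) = map_tuple (up g) t.
  by apply: eq_from_tnth => i; rewrite !tnth_map upE.
by rewrite /= !E.
Qed.

Section Sum.
Variables (T T' V : finType).

Definition ffun_sum (hh : {ffun T -> V} * {ffun T' -> V}) : {ffun T + T' -> V} :=
  [ffun a => match a with inl b => hh.1 b | inr b => hh.2 b end].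

Lemma ffun_sum_bij : bijective ffun_sum.
Proof.
exists (fun h : {ffun T + T' -> V} => ([ffun a => h (inl a)], [ffun a => h (inr a)])) => [[h1 h2]|h].
  by congr (_, _); apply/ffunP => a; rewrite !ffunE.
by apply/ffunP => -[a|a]; rewrite !ffunE.
Qed.

Lemma ffun_suml hh a : ffun_sum hh (inl a) = hh.1 a. Proof. by rewrite ffunE. Qed.
Lemma ffun_sumr hh a : ffun_sum hh (inr a) = hh.2 a. Proof. by rewrite ffunE. Qed.

Lemma big_ffun_sum (P : {ffun T + T' -> V} -> nat) :
  (\sum_h P h = \sum_h1 \sum_h2 P (ffun_sum (h1, h2)))%N.
Proof.
rewrite (reindex _ (onW_bij _ ffun_sum_bij)) /=.
by rewrite (pair_big predT predT (fun h1 h2 => P (ffun_sum (h1, h2)))); apply: eq_bigr => -[].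
Qed.

Lemma map_inl_sum hh (t : k.-tuple T) :
  map_tuple (ffun_sum hh) (map_tuple inl t) = map_tuple hh.1 t.
Proof. by apply: eq_from_tnth => i; rewrite !tnth_map ffun_suml. Qed.

Lemma map_inr_sum hh (t : k.-tuple T') :
  map_tuple (ffun_sum hh) (map_tuple inr t) = map_tuple hh.2 t.
Proof. by apply: eq_from_tnth => i; rewrite !tnth_map ffun_sumr. Qed.

End Sum.

Lemma is_hom_sum F F' (V : finType) (e : rel V) hh (s t : k.-tuple (bV F + bV F')%type) :
  is_hom (BGraph (bV F + bV F')%type (sum_rel (bE F) (bE F')) s t) e (ffun_sum hh) =
  is_hom F e hh.1 && is_hom F' e hh.2.
Proof.
apply/is_homP/andP => [H|[/is_homP H1 /is_homP H2] [a|a] [b|b] //=].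
- split; apply/is_homP => a b Eab.
    by have := H (inl a) (inl b) Eab; rewrite !ffun_suml.
  by have := H (inr a) (inr b) Eab; rewrite !ffun_sumr.
- by rewrite !ffun_suml; apply: H1.
- by rewrite !ffun_sumr; apply: H2.
Qed.

(** A map on the disjoint union is a pair [(h1, h2)]; constancy along the gluing relation says that
    [h2] on [bin F'] agrees with [h1] on [bout F]. *)
Lemma hcount_series F F' (V : finType) (e : rel V) x z :
  hcount (series F F') e x z = (\sum_y hcount F e x y * hcount F' e y z)%N.
Proof.
rewrite hcount_quot big_mkcond big_ffun_sum /=.
under [RHS]eq_bigr => y _ do rewrite big_distrl.
rewrite [RHS]exchange_big /=.
apply: eq_bigr => h1 _.
under [RHS]eq_bigr => y _ do rewrite big_distrr.
rewrite [RHS]exchange_big; apply: eq_bigr => h2 _ /=.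
(* Given [h1], only its image of [bout F] can occur as the middle tuple [y]. *)
rewrite (bigD1 (map_tuple h1 (bout F))) //= [X in (_ + X)%N]big1 ?addn0; last first.
  by move=> y ny; rewrite /hcond [_ == y]eq_sym (negbTE ny) !andbF.
rewrite /hcond /= is_hom_sum map_inl_sum map_inr_sum /= eqxx andbT mulnb.
rewrite (_ : constant_along _ _ = (map_tuple h2 (bin F') == map_tuple h1 (bout F))).
  by case: (_ == map_tuple h1 (bout F)); rewrite /= ?andbF // andbACA.
apply/constant_alongP/map_tuple_eqP => [H i|H a b /existsP [i /andP [/eqP -> /eqP ->]]].
  rewrite tnth_map; have := H (inl (tnth (bout F) i)) (inr (tnth (bin F') i)).
  by rewrite ffun_suml ffun_sumr /= => -> //; apply/existsP; exists i; rewrite !eqxx.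
by rewrite ffun_suml ffun_sumr H tnth_map.
Qed.

(** As for series composition, but the gluing ties both label tuples of [h2] to those of [h1], so no
    middle tuple is summed over. *)
Lemma hcount_parallel F F' (V : finType) (e : rel V) x y :
  hcount (parallel F F') e x y = (hcount F e x y * hcount F' e x y)%N.
Proof.
rewrite hcount_quot big_mkcond big_ffun_sum /=.
rewrite big_distrl /=.
apply: eq_bigr => h1 _; rewrite big_distrr; apply: eq_bigr => h2 _ /=.
rewrite /hcond /= is_hom_sum !map_inl_sum /= mulnb.
rewrite (_ : constant_along _ _ = (map_tuple h2 (bin F') == map_tuple h1 (bin F)) &&
    (map_tuple h2 (bout F') == map_tuple h1 (bout F))).
  case: is_hom; rewrite ?if_same //=; case: is_hom; rewrite ?andbF ?if_same //=.
  have [->|_] := eqVneq _ x; rewrite /= ?if_same //.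
  by have [->|_] := eqVneq _ y; rewrite /= ?if_same //; case: (_ && _).
apply/constant_alongP/andP => [H|[/map_tuple_eqP H1 /map_tuple_eqP H2] a b /existsP [i /orP []]].
- split; apply/map_tuple_eqP => i; rewrite tnth_map.
    have := H (inl (tnth (bin F) i)) (inr (tnth (bin F') i)).
    by rewrite ffun_suml ffun_sumr /= => -> //; apply/existsP; exists i; rewrite !eqxx.
  have := H (inl (tnth (bout F) i)) (inr (tnth (bout F') i)).
  by rewrite ffun_suml ffun_sumr /= => -> //; apply/existsP; exists i; rewrite !eqxx orbT.
- by move=> /andP [/eqP -> /eqP ->]; rewrite ffun_suml ffun_sumr H1 tnth_map.
- by move=> /andP [/eqP -> /eqP ->]; rewrite ffun_suml ffun_sumr H2 tnth_map.
Qed.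

Lemma homMx_series F F' (V : finType) (e : rel V) :
  homMx (series F F') e = mxmul (homMx F e) (homMx F' e).
Proof.
apply: mx_ext => x z; rewrite homMxE hcount_series natr_sum.
by apply: eq_bigr => y _; rewrite !homMxE natrM.
Qed.

Lemma homMx_parallel F F' (V : finType) (e : rel V) :
  homMx (parallel F F') e = mxhad (homMx F e) (homMx F' e).
Proof. by apply: mx_ext => x y; rewrite homMxE hcount_parallel natrM /mxhad !homMxE. Qed.

End HomCount.

(** * Rotations and transposition *)

(** Splits only on comparisons free of inner conditionals, so that nested ones are resolved from the
    inside out. *)
Ltac split_ifs := repeat match goal with
  | |- context [if leq ?a ?b then _ else _] =>
    lazymatch constr:((a, b)) with
    | context [if _ then _ else _] => fail
    | _ => case: (leqP a b) => ? /=
    end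
  end.

Section Rotation.
Variable k : nat.
Lemma cyc_swap_lt p : (p < k + k)%N -> (cyc_swap k p < k + k)%N.
Proof. by rewrite /cyc_swap => ?; case: ifP => ?; lia. Qed.

Lemma cyc_swapK p : (p < k + k)%N -> cyc_swap k (cyc_swap k p) = p.
Proof. by rewrite /cyc_swap => ?; case: (ltnP p k) => ?; case: ifP => ?; lia. Qed.

Lemma tnth_catl (T : Type) (x y : k.-tuple T) i : tnth (cat_tuple x y) (lshift k i) = tnth x i.
Proof. exact: tnth_lshift. Qed.

Lemma tnth_catr (T : Type) (x y : k.-tuple T) i : tnth (cat_tuple x y) (rshift k i) = tnth y i.
Proof. exact: tnth_rshift. Qed.

Lemma map_cat_eqP (T V : finType) (f : T -> V) (s t : k.-tuple T) (x y : k.-tuple V) :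
  reflect (forall m, f (tnth (cat_tuple s t) m) = tnth (cat_tuple x y) m)
    ((map_tuple f s == x) && (map_tuple f t == y)).
Proof.
apply: (iffP andP) => [[/map_tuple_eqP H1 /map_tuple_eqP H2] m|H].
  by case: (split_ordP m) => i ->; rewrite ?tnth_catl ?tnth_catr.
by split; apply/map_tuple_eqP => i;
  [have := H (lshift k i)|have := H (rshift k i)]; rewrite ?tnth_catl ?tnth_catr.
Qed.

(** Exchanges in-label [i] with out-label [i]. It preserves the edges of [Ck] and of [Mk], which is
    the source of all transposes below. *)
Definition half_swap (m : 'I_(k + k)) : 'I_(k + k) :=
  match split m with inl i => rshift k i | inr i => lshift k i end.

Lemma half_swapl i : half_swap (lshift k i) = rshift k i.
Proof.
by rewrite /half_swap; case: splitP => j /= ji; [congr rshift; exact: val_inj|have := ltn_ord i; lia].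
Qed.

Lemma half_swapr i : half_swap (rshift k i) = lshift k i.
Proof.
rewrite /half_swap; case: splitP => j /= ji; first by case: j ji => /=; lia.
by congr lshift; apply: val_inj => /=; lia.
Qed.

Lemma half_swapE m : half_swap m = (if (m < k)%N then m + k else m - k)%N :> nat.
Proof.
by rewrite /half_swap; case: splitP => j /= ->; lia.
Qed.

Lemma half_swapK : involutive half_swap.
Proof.
by move=> m; apply: val_inj; rewrite /= !half_swapE; case: m => m /= ?; case: (ltnP m k) => ?; case: ifP; lia.
Qed.

Lemma tnth_half_swap (T : Type) (x y : k.-tuple T) m :
  tnth (cat_tuple x y) (half_swap m) = tnth (cat_tuple y x) m.
Proof.
by case: (split_ordP m) => i ->;
  rewrite ?half_swapl ?half_swapr ?tnth_catl ?tnth_catr.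
Qed.

Lemma modn_add_if a r K : (a < K)%N -> (r < K)%N ->
  ((a + r) %% K = if a + r < K then a + r else a + r - K)%N.
Proof.
move=> aK rK; case: ifP => H; first by rewrite modn_small.
by rewrite -[in LHS](@subnK K (a + r)) ?modnDr ?modn_small; lia.
Qed.

Lemma cyc_swap_half_swap (m : 'I_(k + k)) :
  cyc_swap k (half_swap m) = (k + k - 1 - cyc_swap k m)%N.
Proof.
by rewrite half_swapE /cyc_swap; case: m => m /= ?; split_ifs; lia.
Qed.

Lemma cyc_swap_inj (m m' : 'I_(k + k)) : cyc_swap k m = cyc_swap k m' -> m = m'.
Proof. by move=> /(congr1 (cyc_swap k)); rewrite !cyc_swapK // => /val_inj. Qed.

Hypothesis k_gt0 : (0 < k)%N.

Lemma sigmaE j (x : 'I_(k + k)) :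
  sigma j x = cyc_swap k ((cyc_swap k x + j) %% (k + k)) :> nat.
Proof.
rewrite /sigma val_insubd cyc_swap_lt //; apply: ltn_pmod; lia.
Qed.

Lemma sigma_inj j : injective (@sigma k j).
Proof.
move=> x y /(congr1 (@nat_of_ord _)); rewrite !sigmaE => /(congr1 (cyc_swap k)).
have K0 : (0 < k + k)%N by lia.
rewrite !cyc_swapK ?ltn_pmod // => /eqP; rewrite eqn_modDr => /eqP.
rewrite !modn_small ?cyc_swap_lt // => /(congr1 (cyc_swap k)).
by rewrite !cyc_swapK // => /val_inj.
Qed.

(** The search performed inside [mxrot]. As [sigma j] is an injection of a finite type into itself,
    the search always succeeds and yields the inverse. *)
Definition sinv j (m : 'I_(k + k)) : 'I_(k + k) := odflt m [pick i | sigma j i == m].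

Lemma sigmaK j : cancel (sigma j) (sinv j).
Proof.
move=> i; rewrite /sinv; case: pickP => [i' /eqP /sigma_inj //|/(_ i)].
by rewrite eqxx.
Qed.

Lemma sinvK j : cancel (sinv j) (sigma j).
Proof. by move=> m; have [s' _ s'K] := injF_bij (@sigma_inj j); rewrite -[m]s'K sigmaK. Qed.

Definition rot_in (V : finType) j (x y : k.-tuple V) : k.-tuple V :=
  [tuple tnth (cat_tuple x y) (sinv j (lshift k i)) | i < k].
Definition rot_out (V : finType) j (x y : k.-tuple V) : k.-tuple V :=
  [tuple tnth (cat_tuple x y) (sinv j (rshift k i)) | i < k].

Lemma mxrotE (V : finType) j (X : mx k V) x y : mxrot j X x y = X (rot_in j x y) (rot_out j x y).
Proof. by []. Qed.

Lemma tnth_rot_cat (V : finType) j (x y : k.-tuple V) m :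
  tnth (cat_tuple (rot_in j x y) (rot_out j x y)) m = tnth (cat_tuple x y) (sinv j m).
Proof.
by case: (split_ordP m) => i ->; rewrite ?tnth_catl ?tnth_catr tnth_mktuple.
Qed.

Lemma tnth_rot_bg_cat j (F : bgraph k) m :
  tnth (cat_tuple (bin (rot_bg j F)) (bout (rot_bg j F))) m =
  tnth (cat_tuple (bin F) (bout F)) (sigma j m).
Proof.
by case: (split_ordP m) => i ->; rewrite ?tnth_catl ?tnth_catr tnth_mktuple.
Qed.

Lemma homMx_rot j (F : bgraph k) (V : finType) (e : rel V) :
  homMx (rot_bg j F) e = mxrot j (homMx F e).
Proof.
apply: mx_ext => x y; rewrite mxrotE !homMxE; congr (_%:R).
apply: eq_bigr => h _; congr (nat_of_bool _); rewrite /hcond; congr andb.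
apply/map_cat_eqP/map_cat_eqP => H m.
  by rewrite tnth_rot_cat -H tnth_rot_bg_cat sinvK.
by rewrite tnth_rot_bg_cat H tnth_rot_cat sigmaK.
Qed.

Definition soe (V : finType) (X : mx k V) : CC := \sum_x \sum_y X x y.

(** A rotation only permutes the index pairs [(x, y)]. *)
Lemma soe_rot (V : finType) j (X : mx k V) : soe (mxrot j X) = soe X.
Proof.
rewrite /soe !pair_big /=.
pose r (p : k.-tuple V * k.-tuple V) := (rot_in j p.1 p.2, rot_out j p.1 p.2).
rewrite [RHS](reindex_inj (h := r)) //.
move=> [x y] [x' y'] H; have e1 := congr1 fst H; have e2 := congr1 snd H; rewrite /= in e1 e2.
have E m : tnth (cat_tuple x y) m = tnth (cat_tuple x' y') m.
  by rewrite -[m](sigmaK j) -!tnth_rot_cat e1 e2.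
by congr (_, _); apply: eq_from_tnth => i;
  [have := E (lshift k i)|have := E (rshift k i)]; rewrite ?tnth_catl ?tnth_catr.
Qed.

Definition mxT (V : finType) (X : mx k V) : mx k V := fun x y => X y x.

Lemma cyc_swap_sigma j (m : 'I_(k + k)) :
  cyc_swap k (sigma j m) = ((cyc_swap k m + j) %% (k + k))%N.
Proof. by rewrite sigmaE cyc_swapK // ltn_pmod; lia. Qed.

(* [half_swap] is a reflection of the cyclic order, so it inverts rotations *)
Lemma sigma_half_swap j m :
  sigma j (half_swap m) = half_swap (sigma (k + k - j %% (k + k)) m).
Proof.
apply: cyc_swap_inj; rewrite cyc_swap_half_swap !cyc_swap_sigma cyc_swap_half_swap.
have K0 : (0 < k + k)%N by lia.
have := ltn_pmod j K0; rewrite -(modnDmr _ j) -(modnDmr _ (_ - _)%N).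
set r := (j %% (k + k))%N => rK.
(* For [r = 0] the amount [k + k - r] is a full turn and reduces to [0]. *)
have -> : ((k + k - r) %% (k + k) = if r == 0 then 0 else k + k - r)%N.
  by case: eqP => [->|r0]; rewrite ?subn0 ?modnn // modn_small; lia.
move: (cyc_swap k m) (cyc_swap_lt (ltn_ord m)) => p pK.
have h1 : ((if r == 0 then 0 else k + k - r) < k + k)%N by case: eqP => r0; lia.
rewrite !modn_add_if //; first by case: eqP h1 => r0 _; split_ifs; lia.
lia.
Qed.

Lemma sinv_half_swap j m :
  half_swap (sinv j m) = sinv (k + k - j %% (k + k)) (half_swap m).
Proof.
apply: (can_inj half_swapK); rewrite half_swapK; apply: (@sigma_inj j).
by rewrite sinvK sigma_half_swap sinvK half_swapK.
Qed.

(** The amount [k + k - j %% (k + k)] represents [-j] modulo [2k]: transposition composes the [2k]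
    labels with the reflection [half_swap]. *)
Lemma mxT_rot (V : finType) j (X : mx k V) :
  mxT (mxrot j X) = mxrot (k + k - j %% (k + k)) (mxT X).
Proof.
apply: mx_ext => x y; rewrite /mxT !mxrotE; congr X; apply: eq_from_tnth => i;
  rewrite !tnth_mktuple -tnth_half_swap sinv_half_swap ?half_swapl ?half_swapr //.
Qed.

End Rotation.

(** * Matrices of minors *)

Section Minors.
Variable k : nat.
Implicit Type F : bgraph k.

Lemma minor_trans F1 F2 F3 : minor_of F1 F2 -> minor_of F2 F3 -> minor_of F1 F3.
Proof.
move=> m12; elim=> [//|F a b _ m1 Eab|F a b _ m1 Eab ab|F a H _ m1].
- exact: mo_del_edge.
- exact: mo_contract.
- exact: mo_del_vertex.
Qed.

(** Edges outside [S] are deleted one at a time; [S] is symmetric because [del_edge] removes both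
    orientations. The remaining relation is described pointwise only, as iterated deletion need not
    produce the intersection literally. *)
Lemma minor_restrict F (S : rel (bV F)) : symmetric S ->
  exists2 E' : rel (bV F), forall a b, E' a b = bE F a b && S a b
    & minor_of F (BGraph (bV F) E' (bin F) (bout F)).
Proof.
move: {2}(#|_|) (leqnn #|[set p | bE F p.1 p.2 && ~~ S p.1 p.2]|) => n.
elim: n F S => [|n IH] F S cardF symS.
  exists (bE F); last by case: F S cardF symS => *; apply: mo_refl.
  move=> a b; move: cardF; rewrite leqn0 cards_eq0 => /eqP /setP /(_ (a, b)).
  by rewrite !inE /=; case: bE; case: (S a b).
have [/existsP [[a b] /= /andP [Eab Sab]]|none] :=
  boolP [exists p : bV F * bV F, bE F p.1 p.2 && ~~ S p.1 p.2]; last first.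
  exists (bE F); last by case: F S cardF symS none => *; apply: mo_refl.
  move=> a b; move: none; rewrite negb_exists => /forallP /(_ (a, b)) /=.
  by case: bE; case: (S a b).
have [|E' E'E m'] := IH (del_edge F a b) S _ symS.
  rewrite -ltnS; apply: leq_trans cardF; apply/proper_card/properP; split.
    by apply/subsetP => p; rewrite !inE /= => /andP [/andP [-> _] ->].
  by exists (a, b); rewrite !inE /= ?Eab ?Sab // !eqxx andbF.
exists E'; last by apply: minor_trans m'; apply: mo_del_edge Eab; apply: mo_refl.
move=> c d; rewrite E'E /=; case: bE => //=.
have [/orP [] /andP [/eqP -> /eqP ->]|_ //] :=
  boolP (((c == a) && (d == b)) || ((c == b) && (d == a))).
  by rewrite (negbTE Sab).
by rewrite symS (negbTE Sab).
Qed.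

(** For the target [eq_op], the edge already forces equal values at [a] and [b], which is the
    identification that contraction makes. *)
Lemma hcount_contract F a b (V : finType) (x y : k.-tuple V) : bE F a b ->
  hcount (contract F a b) eq_op x y = hcount F eq_op x y.
Proof.
move=> Eab; rewrite hcount_quot big_mkcond; apply: eq_bigr => h _.
rewrite /hcond /=.
have -> : is_hom F eq_op h =
    constant_along (fun c d => (c == a) && (d == b)) h && is_hom (del_edge F a b) eq_op h.
  apply/is_homP/andP => [H|[/constant_alongP Hc /is_homP H] c d Ecd].
    split; first by apply/constant_alongP => c d /andP [/eqP -> /eqP ->]; apply/eqP/H.
    by apply/is_homP => c d /andP [/H].
  have [/orP [] /andP [/eqP -> /eqP ->]|n] :=
    boolP (((c == a) && (d == b)) || ((c == b) && (d == a))).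
  - by rewrite (Hc a b) ?eqxx.
  - by rewrite (Hc a b) ?eqxx.
  by apply: H; rewrite /= Ecd.
by case: constant_along.
Qed.

(* Homomorphisms to the reflexive relation [eq_op] are the maps that are
   constant along edges. *)
Lemma contract_all F : exists2 F', minor_of F F' &
  forall (V : finType) (e : rel V) x y, hcount F' e x y = hcount F eq_op x y.
Proof.
move: {2}(#|_|) (leqnn #|bV F|) => n.
elim: n F => [|n IH] F cardF; last first.
  have [/existsP [[a b] /= /andP [Eab ab]]|none] :=
    boolP [exists p : bV F * bV F, bE F p.1 p.2 && (p.1 != p.2)].
    have [|F' m' hF'] := IH (contract F a b).
      rewrite -ltnS; apply: leq_trans cardF.
      (* Contraction merges the distinct ends [a] and [b], so the root map is not injective and the
         vertex count drops. *)
      rewrite /= card_sig ltn_neqAle -[X in _ && (_ <= X)%N]cardsT leq_imset_card andbT.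
      apply/negP => /eqP E; case/negP: ab; apply/eqP.
      have /imset_injP inj : #|gen_root (fun c d => (c == a) && (d == b)) @: [set: bV F]| == #|[set: bV F]|.
        by rewrite cardsT -[X in _ == X]E; apply/eqP/eq_card => c; rewrite inE.
      by apply: inj; rewrite ?inE //; apply: gen_root_rel; rewrite !eqxx.
    exists F'; first by apply: minor_trans m'; apply: mo_contract => //; apply: mo_refl.
    by move=> V e x y; rewrite hF' hcount_contract.
  (* Only loops are left. They impose nothing for [eq_op], but would for an irreflexive [e], so they
     are deleted. *)
  have [|E' E'E m'] := @minor_restrict F (fun _ _ => false); first by [].
  eexists; first exact: m'.
  move=> V e x y; apply: eq_bigr => h _; rewrite /hcond /=; congr (nat_of_bool (andb _ _)).
  transitivity true; first by apply/is_homP => a b /=; rewrite E'E andbF.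
  apply/esym/is_homP => a b Eab; move: none; rewrite negb_exists => /forallP /(_ (a, b)) /=.
  by rewrite Eab negbK => /eqP ->.
exists F; first exact: mo_refl.
move=> V e x y; apply: eq_bigr => h _; rewrite /hcond /=; congr (nat_of_bool (andb _ _)).
have no (a : bV F) : False by move: cardF; rewrite leqn0 => /eqP /card0_eq /(_ a); rewrite inE.
by apply/is_homP/is_homP => _ a; case: (no a).
Qed.

(** The edges outside [S] are deleted and the others contracted; what remains are equalities between
    labels, whatever the target graph. *)
Lemma contract_some (E S : rel 'I_(k + k)) : symmetric S ->
  exists2 F', minor_of (BGraph 'I_(k + k) E (in_lab k) (out_lab k)) F' &
  forall (V : finType) (e : rel V) x y, homMx F' e x y =
    [forall a, forall b, E a b && S a b ==>
      (tnth (cat_tuple x y) a == tnth (cat_tuple x y) b)]%:R.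
Proof.
set F := BGraph _ _ _ _ => symS.
have [E' E'E m'] := @minor_restrict F S symS.
have [F' m'' hF'] := contract_all (BGraph 'I_(k + k) E' (in_lab k) (out_lab k)).
exists F'; first exact: minor_trans m''.
move=> V e x y; rewrite homMxE hF'; congr (_%:R).
(* Every vertex is labelled, so [x] and [y] determine the map and the count is [0] or [1]. *)
rewrite /hcount (bigD1 [ffun m => tnth (cat_tuple x y) m]) //= big1 ?addn0; last first.
  move=> h nh; rewrite /hcond; case: map_cat_eqP; rewrite ?andbF // => H.
  case/negP: nh; apply/eqP/ffunP => m; rewrite ffunE -H /=; congr (h _).
  by case: (split_ordP m) => i ->; rewrite ?tnth_catl ?tnth_catr tnth_mktuple.
rewrite /hcond (_ : (_ == x) && (_ == y) = true); last first.
  apply/map_cat_eqP => m; rewrite ffunE; congr tnth.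
  by case: (split_ordP m) => i ->; rewrite ?tnth_catl ?tnth_catr tnth_mktuple.
rewrite andbT; congr nat_of_bool; apply/is_homP/forallP => [H a|H a b /=].
  by apply/forallP => b; apply/implyP; have := H a b; rewrite /= E'E !ffunE.
by have /forallP /(_ b) /implyP := H a; rewrite E'E !ffunE.
Qed.

(** The rungs of [Mk] selected by [P] are contracted, the others deleted. [predT] gives the
    identity, [pred0] the all-ones matrix, [off_middle] the identity without its middle wire. *)
Lemma QS_partial_identity (P : pred 'I_k) :
  exists2 F : bgraph k, inQS F & forall (V : finType) (e : rel V) x y,
    homMx F e x y = [forall i, P i ==> (tnth x i == tnth y i)]%:R.
Proof.
pose S0 (a b : 'I_(k + k)) := [exists i, [&& P i, a == lshift k i & b == rshift k i]].
pose S (a b : 'I_(k + k)) := S0 a b || S0 b a.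
have symS : symmetric S by move=> a b; rewrite /S orbC.
have [F mF hF] := @contract_some (bE (Mk k)) S symS.
exists F => // V e x y; rewrite hF; congr (nat_of_bool _)%:R.
apply/forallP/forallP => [H i|H a].
  apply/implyP => Pi; have /forallP /(_ (rshift k i)) /implyP := H (lshift k i).
  rewrite tnth_catl tnth_catr; apply; apply/andP; split.
    by apply/orP; left; rewrite /Medge /= ltn_ord addnC eqxx.
  by apply/orP; left; apply/existsP; exists i; rewrite Pi !eqxx.
apply/forallP => b; apply/implyP => /andP [_ /orP []] /existsP [i /and3P [Pi /eqP -> /eqP ->]];
  by rewrite tnth_catl tnth_catr; have /implyP /(_ Pi) /eqP -> := H i.
Qed.

(** The edge of [Ck] joining the last in-label and the last out-label is contracted if [c] holds;
    otherwise all edges are deleted, which gives the all-ones matrix. With [c := odd k] both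
    parities are treated at once. *)
Lemma QP_last_identity (c : bool) (l : 'I_k) : l = k.-1 :> nat ->
  exists2 F : bgraph k, inQP F & forall (V : finType) (e : rel V) x y,
    homMx F e x y = (c ==> (tnth x l == tnth y l))%:R.
Proof.
move=> lE.
pose S0 (a b : 'I_(k + k)) := [&& c, a == lshift k l & b == rshift k l].
pose S (a b : 'I_(k + k)) := S0 a b || S0 b a.
have symS : symmetric S by move=> a b; rewrite /S orbC.
have [F mF hF] := @contract_some (bE (Ck k)) S symS.
exists F => // V e x y; rewrite hF; congr (nat_of_bool _)%:R.
apply/forallP/implyP => [H cT|H a].
  have /forallP /(_ (rshift k l)) /implyP := H (lshift k l).
  rewrite tnth_catl tnth_catr; apply; apply/andP; split.
    by apply/orP; left; rewrite /Cedge /= lE eqxx /=; apply/orP; right; apply/orP; right; have := ltn_ord l; lia.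
  by apply/orP; left; rewrite /S0 cT !eqxx.
apply/forallP => b; apply/implyP => /andP [_ /orP []] /and3P [cT /eqP -> /eqP ->];
  by rewrite tnth_catl tnth_catr (eqP (H cT)).
Qed.

End Minors.

(** * Reflected bilabelled graphs *)

Section Transpose.
Variable k : nat.
Implicit Type F : bgraph k.

Definition anti_iso F F' (f : bV F -> bV F') (g : bV F' -> bV F) : Prop :=
  [/\ cancel f g, cancel g f, forall a b, bE F' (f a) (f b) = bE F a b,
      bin F' = map_tuple f (bout F) & bout F' = map_tuple f (bin F)].

Lemma hcount_anti_iso F F' f g (V : finType) (e : rel V) x y :
  @anti_iso F F' f g -> hcount F' e x y = hcount F e y x.
Proof.
move=> [fK gK fE Ei Eo].
pose up (h : {ffun bV F -> V}) : {ffun bV F' -> V} := [ffun a => h (g a)].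
have upbij : bijective up.
  exists (fun h : {ffun bV F' -> V} => [ffun a => h (f a)] : {ffun bV F -> V}) => h.
    by apply/ffunP => a; rewrite !ffunE fK.
  by apply/ffunP => a; rewrite !ffunE gK.
rewrite /hcount (reindex _ (onW_bij _ upbij)); apply: eq_bigr => h _; congr nat_of_bool.
have E (t : k.-tuple (bV F)) : map_tuple (up h) (map_tuple f t) = map_tuple h t.
  by apply: eq_from_tnth => i; rewrite !tnth_map ffunE fK.
rewrite /hcond Ei Eo !E [X in _ && X = _]andbC; congr andb.
apply/is_homP/is_homP => H a b.
  by rewrite -fE => /H; rewrite !ffunE !fK.
by rewrite !ffunE -{1}[a]gK -{1}[b]gK fE; apply: H.
Qed.

Lemma img_root_val (T : finType) (R : rel T) (a : img_type (gen_root R)) :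
  gen_root R (val a) = val a.
Proof. by have [b ->] := img_eltP a; rewrite /= gen_root_idem. Qed.

Lemma gen_root_map (T T' : finType) (R : rel T) (R' : rel T') (f : T -> T') a b :
  (forall a b, R a b -> R' (f a) (f b)) ->
  gen_root R a = gen_root R b -> gen_root R' (f a) = gen_root R' (f b).
Proof.
move=> fR; apply: (@gen_rootE _ _ R (fun a => gen_root R' (f a))) => c d /fR.
exact: gen_root_rel.
Qed.

(** Since [f] need not send chosen representatives to chosen ones, the induced map takes the root
    again after applying [f]. *)
Lemma anti_iso_quot F F' R R' f g : @anti_iso F F' f g ->
  (forall a b, R' (f a) (f b) = R a b) ->
  exists f' g', @anti_iso (quot_bg F R) (quot_bg F' R') f' g'.
Proof.
move=> [fK gK fE Ei Eo] fR.
have fR1 a b : R a b -> R' (f a) (f b) by rewrite fR.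
have gR1 a b : R' a b -> R (g a) (g b) by rewrite -fR !gK.
pose f' (a : bV (quot_bg F R)) : bV (quot_bg F' R') := img_elt (gen_root R') (f (val a)).
pose g' (a : bV (quot_bg F' R')) : bV (quot_bg F R) := img_elt (gen_root R) (g (val a)).
have labE (t : k.-tuple (bV F)) : map_tuple (img_elt (gen_root R')) (map_tuple f t) =
    map_tuple f' (map_tuple (img_elt (gen_root R)) t).
  apply: eq_from_tnth => i; rewrite !tnth_map; apply: val_inj => /=.
  by apply: (gen_root_map fR1); rewrite gen_root_idem.
exists f', g'; split; rewrite /= ?Ei ?Eo; try exact: labE.
- move=> a; apply: val_inj; rewrite /= -[RHS]img_root_val -[in RHS](fK (val a)).
  by apply: (gen_root_map gR1); rewrite gen_root_idem.
- move=> a; apply: val_inj; rewrite /= -[RHS]img_root_val -[in RHS](gK (val a)).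
  by apply: (gen_root_map fR1); rewrite gen_root_idem.
move=> a b; apply/existsP/existsP => -[c /existsP [d /and3P [Ecd /eqP ca /eqP db]]].
  have rg c' (a' : bV (quot_bg F R)) : gen_root R' c' = gen_root R' (f (val a')) ->
      gen_root R (g c') = val a'.
    by move=> /(gen_root_map gR1); rewrite fK img_root_val.
  exists (g c); apply/existsP; exists (g d).
  by rewrite -fE !gK Ecd /=; apply/andP; split; apply/eqP; apply: rg.
have rf c' (a' : bV (quot_bg F R)) : gen_root R c' = val a' ->
    gen_root R' (f c') = gen_root R' (f (val a')).
  by move=> ca'; apply: (gen_root_map fR1); rewrite ca' img_root_val.
exists (f c); apply/existsP; exists (f d).
by rewrite fE Ecd /=; apply/andP; split; apply/eqP; apply: rf.
Qed.

Lemma anti_iso_del_edge F F' f g a b : @anti_iso F F' f g ->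
  @anti_iso (del_edge F a b) (del_edge F' (f a) (f b)) f g.
Proof.
move=> [fK gK fE Ei Eo]; split=> //= c d.
by rewrite fE !(inj_eq (can_inj fK)).
Qed.

(** Each minor operation is copied through the current anti-isomorphism, which induces one between
    the results. *)
Lemma anti_iso_minor F0 F0' f0 g0 F : @anti_iso F0 F0' f0 g0 -> minor_of F0 F ->
  exists2 F', minor_of F0' F' & exists f g, @anti_iso F F' f g.
Proof.
move=> iso0; elim=> [|{}F a b _ [F' m' [f [g iso]]] Eab|{}F a b _ [F' m' [f [g iso]]] Eab ab|
    {}F a H _ [F' m' [f [g iso]]]].
- by exists F0'; [apply: mo_refl | exists f0, g0].
- have iso' := anti_iso_del_edge a b iso.
  exists (del_edge F' (f a) (f b)); last by exists f, g.
  by apply: mo_del_edge => //; case: iso => _ _ ->.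
- have iso' := anti_iso_del_edge a b iso; case: iso => fK gK fE _ _.
  exists (contract F' (f a) (f b)).
    by apply: mo_contract; rewrite ?fE // (inj_eq (can_inj fK)).
  by apply: anti_iso_quot iso' _ => c d; rewrite !(inj_eq (can_inj fK)).
- case: (iso) => fK gK fE Ei Eo.
  have H' : f a \notin labels F'.
    move: H; rewrite /labels !mem_cat Ei Eo /= !(mem_map (can_inj fK)).
    by rewrite orbC.
  exists (del_vertex H'); first exact: mo_del_vertex.
  have fa (c : {x | x != a}) : f (val c) != f a by rewrite (inj_eq (can_inj fK)) (valP c).
  have ga (c : {x | x != f a}) : g (val c) != a.
    by case: c => c /=; apply: contraNneq => <-; rewrite gK.
  exists (fun c => exist _ (f (val c)) (fa c)), (fun c => exist _ (g (val c)) (ga c)); split.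
  + by move=> c; apply: val_inj; rewrite /= fK.
  + by move=> c; apply: val_inj; rewrite /= gK.
  + by move=> c d; rewrite /= fE.
  + apply: eq_from_tnth => i; rewrite [LHS]tnth_mktuple tnth_map.
    by apply: val_inj; rewrite /= Ei tnth_map tnth_mktuple.
  + apply: eq_from_tnth => i; rewrite [LHS]tnth_mktuple tnth_map.
    by apply: val_inj; rewrite /= Eo tnth_map tnth_mktuple.
Qed.

Lemma map_in_lab : out_lab k = map_tuple (@half_swap k) (in_lab k).
Proof. by apply: eq_from_tnth => i; rewrite [LHS]tnth_mktuple tnth_map tnth_mktuple half_swapl. Qed.

Lemma map_out_lab : in_lab k = map_tuple (@half_swap k) (out_lab k).
Proof. by apply: eq_from_tnth => i; rewrite [LHS]tnth_mktuple tnth_map tnth_mktuple half_swapr. Qed.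

(** Edges of the in-path and of the out-path are exchanged with their direction kept; the two edges
    between the paths are reversed, whence the disjunction. *)
Lemma half_swap_Cedge a b : Cedge k a b ->
  Cedge k (half_swap a) (half_swap b) || Cedge k (half_swap b) (half_swap a).
Proof.
have := ltn_ord a; have := ltn_ord b; rewrite /Cedge !half_swapE.
move: (nat_of_ord a) (nat_of_ord b) => {}a {}b b2k a2k.
case/or3P => [/and3P [/eqP -> ak a2]|/andP [/eqP a0 /eqP bk]|/andP [/eqP ak /eqP bk]].
- have [lt|le] := ltnP a k.
    have -> : (a.+1 < k)%N by lia.
    by apply/orP; left; apply/or3P/Or31/and3P; split; lia.
  have -> : (a.+1 < k = false)%N by lia.
  by apply/orP; left; apply/or3P/Or31/and3P; split; lia.
- have -> : (a < k)%N by lia.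
  have -> : (b < k = false)%N by lia.
  by apply/orP; right; apply/or3P/Or32/andP; split; lia.
- have -> : (a < k)%N by lia.
  have -> : (b < k = false)%N by lia.
  by apply/orP; right; apply/or3P/Or33/andP; split; lia.
Qed.

Lemma half_swap_Medge a b : Medge k a b -> Medge k (half_swap b) (half_swap a).
Proof.
have := ltn_ord a; have := ltn_ord b; rewrite /Medge !half_swapE.
move: (nat_of_ord a) (nat_of_ord b) => {}a {}b b2k a2k /andP [ak /eqP bE].
have -> : (b < k = false)%N by lia.
by rewrite ak; apply/andP; split; lia.
Qed.

Lemma anti_iso_half_swap (E : rel 'I_(k + k)) :
  (forall a b, E a b -> E (half_swap a) (half_swap b)) ->
  let F := BGraph 'I_(k + k) E (in_lab k) (out_lab k) in
  @anti_iso F F (@half_swap k) (@half_swap k).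
Proof.
move=> EE; split; [exact: half_swapK|exact: half_swapK| |exact: map_out_lab|exact: map_in_lab].
by move=> a b; apply/idP/idP => /EE //; rewrite !half_swapK.
Qed.

Lemma anti_iso_Ck : @anti_iso (Ck k) (Ck k) (@half_swap k) (@half_swap k).
Proof.
by apply: anti_iso_half_swap => a b /orP [] /half_swap_Cedge //; rewrite orbC.
Qed.

Lemma anti_iso_Mk : @anti_iso (Mk k) (Mk k) (@half_swap k) (@half_swap k).
Proof.
by apply: anti_iso_half_swap => a b /orP [] /half_swap_Medge ->; rewrite ?orbT.
Qed.

Lemma QP_transpose F : inQP F ->
  exists2 F', inQP F' & forall (V : finType) (e : rel V), homMx F' e = mxT (homMx F e).
Proof.
move=> /(anti_iso_minor anti_iso_Ck) [F' m' [f [g iso]]]; exists F' => // V e.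
by apply: mx_ext => x y; rewrite /mxT !homMxE (hcount_anti_iso _ _ _ iso).
Qed.

Lemma QS_transpose F : inQS F ->
  exists2 F', inQS F' & forall (V : finType) (e : rel V), homMx F' e = mxT (homMx F e).
Proof.
move=> /(anti_iso_minor anti_iso_Mk) [F' m' [f [g iso]]]; exists F' => // V e.
by apply: mx_ext => x y; rewrite /mxT !homMxE (hcount_anti_iso _ _ _ iso).
Qed.

(** Transposition reverses series compositions, commutes with parallel ones and inverts rotations,
    so only the minors of [Ck] and [Mk] need their reflection. *)
Lemma P_transpose F : (0 < k)%N -> inP F ->
  exists2 F', inP F' & forall (V : finType) (e : rel V), homMx F' e = mxT (homMx F e).
Proof.
move=> k0; elim=> {F} [F [/QP_transpose|/QS_transpose] [F' QF' hF']|F1 F2 _ [F1' P1 h1] _ [F2' P2 h2]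
  |F Q _ [F' PF' hF'] /QP_transpose [Q' QQ' hQ']|j F _ [F' PF' hF']].
- by exists F' => //; apply: P_Q; left.
- by exists F' => //; apply: P_Q; right.
- exists (series F2' F1'); first exact: P_series.
  move=> V e; rewrite !homMx_series h1 h2; apply: mx_ext => x z.
  by apply: eq_bigr => y _; rewrite /mxT mulrC.
- exists (parallel F' Q'); first exact: P_par.
  by move=> V e; rewrite !homMx_parallel hF' hQ'.
- exists (rot_bg (k + k - j %% (k + k)) F'); first exact: P_rot.
  by move=> V e; rewrite !homMx_rot // hF' mxT_rot.
Qed.

End Transpose.

(** * The trace as a sum of entries *)

Section Trace.
Variable k : nat.
Hypothesis k_gt0 : (0 < k)%N.

(** Computes the inverse rotation by checking a guessed preimage [p]. *)
Lemma sinv_eq j (m : 'I_(k + k)) p : (p < k + k)%N ->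
  cyc_swap k ((cyc_swap k p + j) %% (k + k)) = m -> sinv j m = p :> nat.
Proof.
move=> pK E; have -> : m = sigma j (Ordinal pK) by apply: val_inj; rewrite /= sigmaE.
by rewrite sigmaK.
Qed.

Section Tuples.
Variables (V : finType) (d : V).
Implicit Types x y c b : k.-tuple V.

Lemma nth_cat_tuple x y p : nth d (cat_tuple x y) p =
  if (p < k)%N then nth d x p else nth d y (p - k).
Proof. by rewrite /= nth_cat size_tuple. Qed.

(** In-labels move up by [j], and the first [j] in-positions receive out-labels in reversed order,
    as the cyclic sequence runs backwards through the out-labels. *)
Lemma tnth_rotl j x y (i : 'I_k) : (j <= k)%N ->
  tnth (rot_in j x y) i = if (j <= i)%N then nth d x (i - j) else nth d y (j - i.+1).
Proof.
move=> jk; rewrite tnth_mktuple (tnth_nth d); have ik := ltn_ord i.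
have [ji|ij] := leqP j i.
  rewrite (@sinv_eq j _ (i - j)) ?nth_cat_tuple; [|lia|].
    by rewrite (_ : (i - j < k)%N); last lia.
  rewrite /cyc_swap /= (_ : (i - j < k)%N); last lia.
  by rewrite subnK // modn_small ?ik; lia.
rewrite (@sinv_eq j _ (k + (j - i.+1))) ?nth_cat_tuple; [|lia|].
  by rewrite ltnNge leq_addr /= addKn.
rewrite /cyc_swap /= [(k + _ < k)%N]ltnNge leq_addr /=.
(* The shifted position passes the end of the cycle and wraps around once. *)
have -> : (3 * k - 1 - (k + (j - i.+1)) + j = i + (k + k))%N by lia.
by rewrite modnDr modn_small ?ik; lia.
Qed.

(** Symmetrically, the last [j] out-positions receive the last [j] in-labels in reversed order. *)
Lemma tnth_rotr j x y (i : 'I_k) : (j <= k)%N ->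
  tnth (rot_out j x y) i = if (k <= i + j)%N then nth d x (k + k - (i + j).+1) else nth d y (i + j).
Proof.
move=> jk; rewrite tnth_mktuple (tnth_nth d); have ik := ltn_ord i.
have lt1 : (k + k - i.+1 < k = false)%N by lia.
have [ji|ij] := leqP k (i + j).
  rewrite (@sinv_eq j _ (k + k - (i + j).+1)) ?nth_cat_tuple; [|lia|].
    by rewrite (_ : (k + k - (i + j).+1 < k)%N); last lia.
  rewrite /cyc_swap /= (_ : (k + k - (i + j).+1 < k)%N); last lia.
  have -> : (k + k - (i + j).+1 + j = k + k - i.+1)%N by lia.
  by rewrite modn_small ?lt1; lia.
rewrite (@sinv_eq j _ (k + (i + j))) ?nth_cat_tuple; [|lia|].
  by rewrite ltnNge leq_addr /= addKn.
rewrite /cyc_swap /= [(k + _ < k)%N]ltnNge leq_addr /=.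
have -> : (3 * k - 1 - (k + (i + j)) + j = k + k - i.+1)%N by lia.
by rewrite modn_small ?lt1; lia.
Qed.

(* The wires that do not cross after a quarter turn: all of them, except the
   middle one when [k] is odd. *)
Definition off_middle : pred 'I_k := fun i => (i < k./2)%N || (k <= i + k./2)%N.

Definition nest_in x : bool :=
  [forall i : 'I_k, (k <= i + k./2)%N ==>
     (nth d x (i - k./2) == nth d x (k + k - (i + k./2).+1))].
Definition nest_out y : bool :=
  [forall i : 'I_k, (i < k./2)%N ==> (nth d y (k./2 - i.+1) == nth d y (i + k./2))].
(** For odd [k] the caps of [nest_in] leave in-position [0] free and those of [nest_out] leave
    out-position [k.-1] free; the middle wire joins these two. *)
Definition cross x y : bool := odd k ==> (nth d x 0 == nth d y k.-1).
Definition same_last x y : bool := odd k ==> (nth d x k.-1 == nth d y k.-1).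

Lemma half_bounds : k = (odd k + (k./2 + k./2))%N.
Proof. by rewrite addnn odd_double_half. Qed.

Lemma rot_partial_identity x y :
  [forall i, off_middle i ==> (tnth (rot_in k./2 x y) i == tnth (rot_out k./2 x y) i)] =
  nest_in x && nest_out y.
Proof.
have kE := half_bounds; have jk : (k./2 <= k)%N by lia.
apply/forallP/andP => [H|[/forallP Hin /forallP Hout] i].
  split; apply/forallP => i; apply/implyP => ci; have := H i;
    rewrite !tnth_rotl // !tnth_rotr // /off_middle ci ?orbT /=.
    by rewrite (_ : (k./2 <= i)%N); last (case: (odd k) kE => /=; lia).
  rewrite leqNgt ci /= leqNgt (_ : (i + k./2 < k)%N) //.
  by case: (odd k) kE => /=; lia.
apply/implyP; rewrite !tnth_rotl // !tnth_rotr // => /orP [] ci.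
  have /implyP /(_ ci) := Hout i.
  rewrite leqNgt ci /= leqNgt (_ : (i + k./2 < k)%N) //.
  by case: (odd k) kE => /=; lia.
have /implyP /(_ ci) := Hin i; rewrite ci.
by rewrite (_ : (k./2 <= i)%N); last (case: (odd k) kE => /=; lia).
Qed.

Lemma rot_identity x y :
  (rot_in k./2 x y == rot_out k./2 x y) = [&& cross x y, nest_in x & nest_out y].
Proof.
have kE := half_bounds; have jk : (k./2 <= k)%N by lia.
rewrite -rot_partial_identity.
have HE : (rot_in k./2 x y == rot_out k./2 x y) =
   [forall i, tnth (rot_in k./2 x y) i == tnth (rot_out k./2 x y) i].
  by apply/eqP/forallP => [->|H] //; apply: eq_from_tnth => i; apply/eqP.
rewrite HE; apply/forallP/andP => [H|[Hc /forallP H] i].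
  split; last by apply/forallP => i; rewrite (H i) implybT.
  apply/implyP => ok; have ik : (k./2 < k)%N by lia.
  have := H (Ordinal ik); rewrite tnth_rotl // tnth_rotr //= leqnn subnn.
  rewrite ok /= in kE.
  by rewrite leqNgt (_ : (k./2 + k./2 < k)%N) 1?(_ : k.-1 = k./2 + k./2)%N //; lia.
have [mi|] := boolP (off_middle i); first by have := H i; rewrite mi.
(* What is left is [k./2 <= i < k - k./2]: the single index [k./2], and only for odd [k]. *)
rewrite /off_middle negb_or -leqNgt -ltnNge => /andP [i1 i2].
have ok : odd k by case: (odd k) kE => //=; lia.
rewrite tnth_rotl // tnth_rotr // i1 leqNgt i2 /=; rewrite ok /= in kE.
have -> : (i - k./2 = 0)%N by lia.
have -> : (i + k./2 = k.-1)%N by lia.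
by move: Hc; rewrite /cross ok.
Qed.

End Tuples.

Lemma mxtr_soe (V : finType) (X : mx k V) : mxtr X = soe (mxhad (mxI V) X).
Proof.
apply: eq_bigr => x _; rewrite (bigD1 x) //= big1 ?addr0 /mxhad /mxI ?eqxx ?mul1r //.
by move=> y yx; rewrite eq_sym (negbTE yx) mul0r.
Qed.

Lemma sum_nat_gt0 (T : finType) (P : pred T) (t : T) : P t -> (0 < \sum_t P t)%N.
Proof. by move=> Pt; rewrite (bigD1 t) //= Pt. Qed.

Section Homogeneity.
Variables (V : finType) (d : V).

Lemma nth_map_tuple (f : V -> V) (c : k.-tuple V) p : (p < k)%N ->
  nth d (map_tuple f c) p = f (nth d c p).
Proof. by move=> pk; rewrite (nth_map d) // size_tuple. Qed.

Lemma nest_out_map (f : V -> V) c : injective f ->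
  nest_out d (map_tuple f c) = nest_out d c.
Proof.
move=> finj; apply: eq_forallb => i; have [ci|//] := boolP (i < k./2)%N.
by have := half_bounds; rewrite !nth_map_tuple ?(inj_eq finj) //; case: (odd k) => /=; lia.
Qed.

Definition nest_weight (b : k.-tuple V) : nat := (\sum_c (same_last d c b && nest_out d c))%N.

(* Permuting the vertices moves any last label to any other. *)
Lemma nest_weight_const b b' : nest_weight b = nest_weight b'.
Proof.
pose f := tperm (nth d b k.-1) (nth d b' k.-1).
have finj : injective f by apply: perm_inj.
have minj : injective (@map_tuple k _ _ f).
  move=> c c' /(congr1 (@tval _ _)) /= /(inj_map finj) E; exact: val_inj.
rewrite /nest_weight [RHS](reindex_inj minj); apply: eq_bigr => c _.
rewrite nest_out_map // /same_last nth_map_tuple; last lia.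
by rewrite -[X in f _ == X](tpermL (nth d b k.-1)) (inj_eq finj).
Qed.

End Homogeneity.

(* In [soe_trace_form], [D] closes up the crossing wire and [I1] is the identity
   without its middle wire, so that its rotation has rank one. *)
Definition trace_form (V : finType) (D I1 X : mx k V) : mx k V :=
  mxmul (mxhad D (mxmul (mxT (mxrot k./2 (mxI V))) (mxrot k./2 X))) (mxT (mxrot k./2 I1)).

(** The trace of [X] is the sum of [Y a b] over the pairs satisfying [cross], [nest_in] and
    [nest_out]. In the product, the left factor puts the in-caps on [a] and the crossing wire
    between [a] and a new tuple [c]; [D] ties [c] to [b]; the right factor puts the out-caps on [b].
    The sums over [c] and the outer tuple [e] give the constant. *)
Lemma soe_trace_form (V : finType) (d : V) (D I1 X : mx k V) :
  (forall x y, D x y = (same_last d x y)%:R) ->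
  (forall x y, I1 x y = [forall i, off_middle i ==> (tnth x i == tnth y i)]%:R) ->
  soe (trace_form D I1 X) =
  (nest_weight d (nseq_tuple k d) * \sum_c (nest_in d c : nat))%N%:R * mxtr X.
Proof.
move=> DE I1E; rewrite mxtr_soe -(soe_rot k_gt0 k./2 (mxhad (mxI V) X)).
set Y := mxrot k./2 X.
have -> : soe (mxrot k./2 (mxhad (mxI V) X)) =
    \sum_a \sum_b (([&& cross d a b, nest_in d a & nest_out d b])%:R * Y a b).
  by apply: eq_bigr => a _; apply: eq_bigr => b _; rewrite mxrotE /mxhad /mxI (rot_identity d).
pose t c e b a : CC := (same_last d c b)%:R *
  (([&& cross d a c, nest_in d a & nest_out d c])%:R * Y a b) * (nest_in d e && nest_out d b)%:R.
pose t' c e b a : CC := (same_last d c b && nest_out d c)%:R * (nest_in d e)%:R *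
    (([&& cross d a b, nest_in d a & nest_out d b])%:R * Y a b).
have tE c e b a : t c e b a = t' c e b a.
  (* The last labels of [c] and [b] agree, so the end of the crossing wire can be moved from [c] to
     [b]. *)
  have crossE : same_last d c b -> cross d a c = cross d a b.
    by rewrite /same_last /cross; case: (odd k) => //= /eqP ->.
  rewrite /t /t'; case: (boolP (same_last d c b)) => [/crossE ->|_]; last by rewrite !mul0r.
  rewrite /= mul1r -!mulrA [_%:R * (Y a b * _)]mulrCA; 
  case: cross; case: (nest_in d a); case: (nest_in d e); case: (nest_out d c); case: (nest_out d b);
    by rewrite /= ?(mul0r, mulr0, mul1r, mulr1).
have -> : soe (trace_form D I1 X) = \sum_c \sum_e \sum_b \sum_a t' c e b a.
  apply: eq_bigr => c _; apply: eq_bigr => e _; apply: eq_bigr => b _.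
  rewrite /mxhad DE /mxmul mulr_sumr mulr_suml; apply: eq_bigr => a _; rewrite -tE.
  by rewrite /mxT !mxrotE I1E (rot_partial_identity d) /mxI (rot_identity d).
(* For fixed [a] and [b] the sums over [c] and [e] separate; the dependence on [b] then disappears
   by [nest_weight_const]. *)
transitivity (\sum_b \sum_a (nest_weight d b * \sum_e (nest_in d e : nat))%N%:R *
    (([&& cross d a b, nest_in d a & nest_out d b])%:R * Y a b) : CC).
  under [LHS]eq_bigr => c _ do rewrite exchange_big.
  rewrite [LHS]exchange_big; apply: eq_bigr => b _.
  under [LHS]eq_bigr => c _ do rewrite exchange_big.
  rewrite [LHS]exchange_big; apply: eq_bigr => a _.
  rewrite natrM !natr_sum !mulr_suml; apply: eq_bigr => c _.
  by rewrite mulr_sumr mulr_suml.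
rewrite exchange_big mulr_sumr; apply: eq_bigr => a _.
rewrite mulr_sumr; apply: eq_bigr => b _.
by rewrite (nest_weight_const d b (nseq_tuple k d)).
Qed.

(** All the conditions are equalities between labels, so a constant tuple satisfies them. *)
Lemma trace_const_gt0 (V : finType) (d : V) :
  (0 < nest_weight d (nseq_tuple k d) * \sum_(c : k.-tuple V) (nest_in d c : nat))%N.
Proof.
have nn p : nth d (nseq_tuple k d) p = d by rewrite nth_nseq if_same.
rewrite muln_gt0; apply/andP; split; apply: (sum_nat_gt0 (t := nseq_tuple k d)).
  apply/andP; split; first by rewrite /same_last !nn eqxx implybT.
  by apply/forallP => i; rewrite !nn eqxx implybT.
by apply/forallP => i; rewrite !nn eqxx implybT.
Qed.

Lemma mxtr_I (V : finType) : mxtr (mxI V : mx k V) = (#|V| ^ k)%N%:R.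
Proof.
rewrite /mxtr /mxI (eq_bigr (fun=> 1)) => [|x _]; last by rewrite eqxx.
by rewrite sumr_const card_tuple.
Qed.

End Trace.

(** * Span of the homomorphism matrices *)

Section Linear.
Variable k : nat.
Variable V : finType.
Implicit Types X Y Z : mx k V.

Lemma conjc_natr n : conjc (n%:R : CC) = n%:R.
Proof. exact: conjc_nat. Qed.

Lemma mxadj_homMx (F : bgraph k) (e : rel V) : mxadj (homMx F e) = mxT (homMx F e).
Proof. by apply: mx_ext => x y; rewrite /mxadj /mxT homMxE conjc_natr. Qed.

(** This trace is the sum of the squared moduli of the entries of [Z]. *)
Lemma mxtr_adj_mul_eq0 Z : mxtr (mxmul (mxadj Z) Z) = 0 -> forall x y, Z x y = 0.
Proof.
have ge0 (z : CC) : 0 <= conjc z * z by rewrite mulrC; exact: (@mul_conjC_ge0 (Rdefinitions.R)[i] z).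
have ge1 x : 0 <= \sum_y conjc (Z y x) * Z y x by apply: sumr_ge0.
move=> /psumr_eq0P H x y; have /psumr_eq0P H' := H (fun x _ => ge1 x) y isT.
have /eqP := H' (fun x _ => ge0 _) x isT.
by rewrite mulf_eq0 => /orP [|/eqP //]; rewrite conjc_eq0 => /eqP.
Qed.

End Linear.

Section Span.
Variable k : nat.
Hypothesis k_gt0 : (0 < k)%N.

(* The graph of the linear map from [homMx F e] to [homMx F e'], once [span_fun] shows that it is one. *)
Inductive span_rel (V V' : finType) (e : rel V) (e' : rel V') : mx k V -> mx k V' -> Prop :=
| span_P F : inP F -> span_rel e e' (homMx F e) (homMx F e')
| span_add X X' Y Y' : span_rel e e' X X' -> span_rel e e' Y Y' ->
    span_rel e e' (mxadd X Y) (mxadd X' Y')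
| span_scale c X X' : span_rel e e' X X' -> span_rel e e' (mxscale c X) (mxscale c X').

Section Fixed.
Variables (V V' : finType) (e : rel V) (e' : rel V').
Notation Rel := (span_rel e e').

(** Through this symmetry, injectivity and surjectivity of the map become functionality and totality
    with the graphs exchanged. *)
Lemma span_sym X X' : Rel X X' -> span_rel e' e X' X.
Proof. by elim=> *; [apply: span_P|apply: span_add|apply: span_scale]. Qed.

Lemma span_mul X X' Y Y' : Rel X X' -> Rel Y Y' -> Rel (mxmul X Y) (mxmul X' Y').
Proof.
move=> HX HY.
elim: HX => {X X'} [F PF|X1 X1' X2 X2' _ IH1 _ IH2|c X X' _ IH]; last first.
- have E (W : finType) (A B : mx k W) : mxmul (mxscale c A) B = mxscale c (mxmul A B).
    apply: mx_ext => x z; rewrite /mxmul /mxscale mulr_sumr.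
    by apply: eq_bigr => y _; rewrite mulrA.
  by rewrite !E; apply: span_scale.
- have E (W : finType) (A B C : mx k W) :
      mxmul (mxadd A B) C = mxadd (mxmul A C) (mxmul B C).
    apply: mx_ext => x z; rewrite /mxmul /mxadd -big_split.
    by apply: eq_bigr => y _; rewrite mulrDl.
  by rewrite !E; apply: span_add.
elim: HY => {Y Y'} [F' PF'|X1 X1' X2 X2' _ IH1 _ IH2|c X X' _ IH].
- by rewrite -!homMx_series; apply: span_P; apply: P_series.
- have E (W : finType) (A B C : mx k W) :
      mxmul C (mxadd A B) = mxadd (mxmul C A) (mxmul C B).
    apply: mx_ext => x z; rewrite /mxmul /mxadd -big_split.
    by apply: eq_bigr => y _; rewrite mulrDr.
  by rewrite !E; apply: span_add.
- have E (W : finType) (A B : mx k W) : mxmul B (mxscale c A) = mxscale c (mxmul B A).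
    apply: mx_ext => x z; rewrite /mxmul /mxscale mulr_sumr.
    by apply: eq_bigr => y _; rewrite mulrCA.
  by rewrite !E; apply: span_scale.
Qed.

Lemma span_had Q X X' : inQP Q -> Rel X X' -> Rel (mxhad (homMx Q e) X) (mxhad (homMx Q e') X').
Proof.
move=> QQ; elim=> {X X'} [F PF|X1 X1' X2 X2' _ IH1 _ IH2|c X X' _ IH].
- have E (W : finType) (A B : mx k W) : mxhad A B = mxhad B A.
    by apply: mx_ext => x y; rewrite /mxhad mulrC.
  by rewrite E [mxhad _ (homMx F e')]E -!homMx_parallel; apply: span_P; apply: P_par.
- have E (W : finType) (A B C : mx k W) :
      mxhad C (mxadd A B) = mxadd (mxhad C A) (mxhad C B).
    by apply: mx_ext => x z; rewrite /mxhad /mxadd mulrDr.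
  by rewrite !E; apply: span_add.
- have E (W : finType) (A B : mx k W) : mxhad B (mxscale c A) = mxscale c (mxhad B A).
    by apply: mx_ext => x z; rewrite /mxhad /mxscale mulrCA.
  by rewrite !E; apply: span_scale.
Qed.

Lemma span_rot j X X' : Rel X X' -> Rel (mxrot j X) (mxrot j X').
Proof.
elim=> {X X'} [F PF|X1 X1' X2 X2' _ IH1 _ IH2|c X X' _ IH].
- by rewrite -!homMx_rot //; apply: span_P; apply: P_rot.
- exact: (span_add IH1 IH2).
- exact: (span_scale c IH).
Qed.

Lemma span_T X X' : Rel X X' -> Rel (mxT X) (mxT X').
Proof.
elim=> {X X'} [F PF|X1 X1' X2 X2' _ IH1 _ IH2|c X X' _ IH].
- by have [F' PF' hF'] := P_transpose k_gt0 PF; rewrite -!hF'; apply: span_P.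
- exact: (span_add IH1 IH2).
- exact: (span_scale c IH).
Qed.

Lemma span_adj X X' : Rel X X' -> Rel (mxadj X) (mxadj X').
Proof.
elim=> {X X'} [F PF|X1 X1' X2 X2' _ IH1 _ IH2|c X X' _ IH].
- by rewrite !mxadj_homMx; apply: span_T; apply: span_P.
- have E (W : finType) (A B : mx k W) : mxadj (mxadd A B) = mxadd (mxadj A) (mxadj B).
    by apply: mx_ext => x z; rewrite /mxadj /mxadd; exact: rmorphD.
  by rewrite !E; apply: span_add.
- have E (W : finType) (A : mx k W) : mxadj (mxscale c A) = mxscale (conjc c) (mxadj A).
    by apply: mx_ext => x z; rewrite /mxadj /mxscale; exact: rmorphM.
  by rewrite !E; apply: span_scale.
Qed.

Lemma span_I : Rel (mxI V) (mxI V').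
Proof.
have [F QF hF] := @QS_partial_identity k predT.
have E (W : finType) (f : rel W) : homMx F f = mxI W.
  apply: mx_ext => x y; rewrite hF /mxI; congr (nat_of_bool _)%:R.
  apply/forallP/eqP => [H|-> i]; last by rewrite eqxx.
  by apply: eq_from_tnth => i; apply/eqP; apply: H.
by rewrite -(E V e) -(E V' e'); apply: span_P; apply: P_Q; right.
Qed.

Lemma span_J : Rel (mxJ V) (mxJ V').
Proof.
have [F QF hF] := @QS_partial_identity k pred0.
have E (W : finType) (f : rel W) : homMx F f = mxJ W.
  apply: mx_ext => x y; rewrite hF /mxJ.
  by have /forallP -> : forall i, pred0 i ==> (tnth x i == tnth y i) by [].
by rewrite -(E V e) -(E V' e'); apply: span_P; apply: P_Q; right.
Qed.

(** The relation is compatible with every operation that generates the algebra, hence total on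
    it. *)
Lemma span_exists X : inQhat e X -> exists X', Rel X X'.
Proof.
elim=> {X} [||F QF|X Y _ [X' HX] _ [Y' HY]|c X _ [X' HX]|X Y _ [X' HX] _ [Y' HY]|X _ [X' HX]
  |F X QF _ [X' HX]|j X _ [X' HX]]; eexists.
- exact: span_I.
- exact: span_J.
- by apply: span_P; apply: P_Q.
- exact: span_add HX HY.
- exact: span_scale HX.
- exact: span_mul HX HY.
- exact: span_adj HX.
- exact: span_had HX.
- exact: span_rot HX.
Qed.

Lemma P_inQhat (F : bgraph k) : inP F -> inQhat e (homMx F e).
Proof.
elim=> {F} [F QF|F1 F2 _ IH1 _ IH2|F Q _ IH QQ|j F _ IH].
- exact: Qh_F.
- by rewrite homMx_series; apply: Qh_mul.
- have -> : homMx (parallel F Q) e = mxhad (homMx Q e) (homMx F e).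
    by rewrite homMx_parallel; apply: mx_ext => x y; rewrite /mxhad mulrC.
  exact: Qh_had.
- by rewrite homMx_rot //; apply: Qh_rot.
Qed.

Lemma span_inQhat X X' : Rel X X' -> inQhat e X.
Proof.
by elim=> *; [apply: P_inQhat|apply: Qh_add|apply: Qh_scale].
Qed.

Lemma soe_homMx (W : finType) (f : rel W) (F : bgraph k) : soe (homMx F f) = (Defs.hom F f)%:R.
Proof.
rewrite homE natr_sum; apply: eq_bigr => x _; rewrite natr_sum.
by apply: eq_bigr => y _; rewrite homMxE.
Qed.

(** The sum of entries is linear and on generators is a homomorphism count; this is where
    indistinguishability enters. *)
Lemma span_soe X X' : hom_indist_P k V V' e e' -> Rel X X' -> soe X = soe X'.
Proof.
move=> ind; elim=> {X X'} [F PF|X1 X1' X2 X2' _ IH1 _ IH2|c X X' _ IH].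
- by rewrite !soe_homMx ind.
- have E (W : finType) (A B : mx k W) : soe (mxadd A B) = soe A + soe B.
    by rewrite /soe -big_split; apply: eq_bigr => x _; rewrite -big_split.
  by rewrite !E IH1 IH2.
- have E (W : finType) (A : mx k W) : soe (mxscale c A) = c * soe A.
    by rewrite /soe mulr_sumr; apply: eq_bigr => x _; rewrite mulr_sumr.
  by rewrite !E IH.
Qed.

(** [trace_form] uses only operations compatible with the relation, so its sums of entries agree on
    both sides; cancelling equal positive constants leaves the traces. *)
Lemma span_tr X X' : #|V| = #|V'| -> hom_indist_P k V V' e e' -> Rel X X' -> mxtr X = mxtr X'.
Proof.
move=> cardV ind HX.
have lk : (k.-1 < k)%N by lia.
(* Without vertices there are no label tuples, as [k] is positive, and both traces are empty
   sums. *)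
case: (pickP (mem V)) => [d _|V0]; last first.
  have V0' : V' =i pred0 by apply: card0_eq; rewrite -cardV; apply: eq_card0.
  rewrite /mxtr !big_pred0 // => x.
    by have := V0' (tnth x (Ordinal lk)).
  by have := V0 (tnth x (Ordinal lk)).
have [d' _] : exists d' : V', true.
  have /card_gt0P [d' _] : (0 < #|V'|)%N by rewrite -cardV; apply/card_gt0P; exists d.
  by exists d'.
have [FD QFD hD] := @QP_last_identity k (odd k) (Ordinal lk) erefl.
have [FI QFI hI] := @QS_partial_identity k (@off_middle k).
have DE (W : finType) (w : W) (f : rel W) x y : homMx FD f x y = (same_last w x y)%:R.
  by rewrite hD /same_last !(tnth_nth w).
have form Z Z' : Rel Z Z' -> Rel (trace_form (homMx FD e) (homMx FI e) Z)
    (trace_form (homMx FD e') (homMx FI e') Z').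
  move=> HZ; apply: span_mul; last by apply/span_T/span_rot/span_P/P_Q; right.
  apply: span_had => //; apply: span_mul; last exact: span_rot.
  by apply/span_T/span_rot/span_I.
have trE := fun Z => soe_trace_form k_gt0 Z (DE V d e) (hI V e).
have trE' := fun Z => soe_trace_form k_gt0 Z (DE V' d' e') (hI V' e').
have := trace_const_gt0 k d; have := trace_const_gt0 k d'.
move: trE trE'.
set c := (nest_weight d _ * _)%N; set c' := (nest_weight d' _ * _)%N => trE trE' c'0 c0.
(* The two constants count tuples over different vertex sets; they are compared by taking the
   identity for [X], whose trace is [#|V| ^ k] on both sides. *)
have cc' : c%:R = c'%:R :> CC.
  have := span_soe ind (form _ _ span_I); rewrite trE trE' !mxtr_I cardV.
  apply: mulIf; rewrite pnatr_eq0 -lt0n expn_gt0; apply/orP; left.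
  by apply/card_gt0P; exists d'.
have := span_soe ind (form _ _ HX); rewrite trE trE' cc'.
by apply: mulfI; rewrite pnatr_eq0 -lt0n.
Qed.

(** The difference [Z'] of two images is related to [X - X], which vanishes. Preservation of traces
    makes the trace of [Z'^* Z'] zero, so [Z'] is zero. *)
Lemma span_fun X X' X'' : #|V| = #|V'| -> hom_indist_P k V V' e e' ->
  Rel X X' -> Rel X X'' -> X' = X''.
Proof.
move=> cardV ind H1 H2.
have HZ := span_add H1 (span_scale (-1) H2).
set Z' := mxadd X' _ in HZ.
have Z0 : forall x y, Z' x y = 0.
  apply: mxtr_adj_mul_eq0; rewrite -(span_tr cardV ind (span_mul (span_adj HZ) HZ)).
  rewrite /mxtr big1 // => x _; rewrite /mxmul big1 // => y _.
  by rewrite /mxadd /mxscale mulN1r subrr mulr0.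
apply: mx_ext => x y; apply/eqP; rewrite -subr_eq0; have := Z0 x y.
by rewrite /Z' /mxadd /mxscale mulN1r => ->.
Qed.

End Fixed.
End Span.

(** * The two implications *)

Lemma alg_equiv_of_hom_indist (k : nat) (V V' : finType) (e : rel V) (e' : rel V') :
  (0 < k)%N -> #|V| = #|V'| -> hom_indist_P k V V' e e' -> alg_equiv k V V' e e'.
Proof.
move=> k0 cardV ind.
have ind' : hom_indist_P k V' V e' e by move=> F /ind ->.
(* A chosen related matrix; [mxJ V'] only witnesses that the type is inhabited, and values outside
   the algebra are arbitrary. *)
pose phi X : mx k V' := epsilon (inhabits (mxJ V')) (span_rel e e' X).
have phiP X : inQhat e X -> span_rel e e' X (phi X).
  by move=> /(span_exists k0 e'); apply: epsilon_spec.
have phiE X X' : span_rel e e' X X' -> phi X = X'.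
  move=> HX; apply: (span_fun k0 cardV ind _ HX).
  by apply: phiP; apply: span_inQhat HX.
exists phi; do 11?[split].
- by move=> X /phiP /span_sym; apply: span_inQhat.
- move=> Y /(span_exists k0 e) [X /span_sym HX]; exists X; last exact: phiE.
  exact: span_inQhat HX.
- move=> X Y /phiP /span_sym HX /phiP /span_sym HY XY; rewrite -XY in HY.
  exact: span_fun HX HY.
- by move=> a b X Y /phiP HX /phiP HY; apply/phiE/span_add; apply: span_scale.
- by move=> X /phiP HX; apply/phiE/span_adj.
- by move=> X Y /phiP HX /phiP HY; apply/phiE/span_mul.
- by move=> F X QF /phiP HX; apply/phiE/span_had.
- exact/phiE/span_I.
- exact/phiE/span_J.
- by move=> F QF; apply/phiE/span_P/P_Q.
- by move=> j X /phiP HX; apply/phiE/span_rot.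
- by move=> X /phiP HX; rewrite (span_tr k0 cardV ind HX).
Qed.

Lemma mxJ_mul_mxJ k (V : finType) (X : mx k V) :
  mxmul (mxmul (mxJ V) X) (mxJ V) = mxscale (soe X) (mxJ V).
Proof.
apply: mx_ext => x z; rewrite /mxmul /mxscale /mxJ mulr1 /soe exchange_big.
by apply: eq_bigr => y _; rewrite mulr1; apply: eq_bigr => w _; rewrite mul1r.
Qed.

Lemma hom_indist_of_alg_equiv (k : nat) (V V' : finType) (e : rel V) (e' : rel V') :
  (0 < k)%N -> #|V| = #|V'| -> alg_equiv k V V' e e' -> hom_indist_P k V V' e e'.
Proof.
move=> k0 cardV [phi [_ [_ [_ [lin [_ [mul [had [_ [phiJ [phiF [rot _]]]]]]]]]]]].
have inJ := Qh_J k V e.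
have phiP (F : bgraph k) : inP F -> phi (homMx F e) = homMx F e'.
  elim=> {F} [F QF|F1 F2 P1 IH1 P2 IH2|F Q PF IH QQ|j F PF IH]; first exact: phiF.
  - by rewrite !homMx_series mul ?IH1 ?IH2 //; apply: P_inQhat.
  - have E (W : finType) (f : rel W) : homMx (parallel F Q) f = mxhad (homMx Q f) (homMx F f).
      by rewrite homMx_parallel; apply: mx_ext => x y; rewrite /mxhad mulrC.
    by rewrite !E had ?IH //; apply: P_inQhat.
  - by rewrite !homMx_rot // rot ?IH //; apply: P_inQhat.
move=> F PF.
(* Multiples of [J] can be compared only through an entry, which requires a vertex; without vertices
   both counts are empty sums. *)
case: (pickP (mem V')) => [d _|V0].
  have inF := P_inQhat k0 e PF.
  have : phi (mxmul (mxmul (mxJ V) (homMx F e)) (mxJ V)) = mxscale (soe (homMx F e')) (mxJ V').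
    by rewrite !mul ?phiJ ?phiP ?mxJ_mul_mxJ //; apply: Qh_mul.
  (* Linearity of [phi] is given for two-term combinations, so a single multiple is padded with a
     zero term. *)
  have E (W : finType) c (X : mx k W) : mxscale c X = mxadd (mxscale c X) (mxscale 0 X).
    by apply: mx_ext => x y; rewrite /mxadd /mxscale mul0r addr0.
  rewrite mxJ_mul_mxJ E lin // phiJ -E => /(congr1 (fun X => X (nseq_tuple k d) (nseq_tuple k d))).
  by rewrite /mxscale /mxJ !mulr1 !soe_homMx => /eqP; rewrite eqr_nat => /eqP.
have V0' : V =i pred0 by apply: card0_eq; rewrite cardV; apply: eq_card0.
rewrite !homE !big_pred0 // => x; first by have := V0 (tnth x (Ordinal k0)).
by have := V0' (tnth x (Ordinal k0)).
Qed.

Theorem theorem4p4 (k : nat) (VG VH : finType) (eG : rel VG) (eH : rel VH) :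
  (1 <= k)%N -> simple_graph VG eG -> simple_graph VH eH -> #|VG| = #|VH| ->
  (hom_indist_P k VG VH eG eH <-> alg_equiv k VG VH eG eH).
Proof.
move=> k0 _ _ cardV; split; first exact: alg_equiv_of_hom_indist.
exact: hom_indist_of_alg_equiv.
Qed.
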